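(* Let $G$ be a finite graph. Then, as polynomials, $$R_G(x,y)=\sum_{[\rho]\in[\mathcal O(G)]}\bar\kappa_\rho(G;x,y),\qquad R_G(-x,-y)=(-1)^{r(G)}\sum_{[\rho]\in[\mathcal O(G)]}(-1)^{|C_\rho|}\kappa_\rho(G;x,y),$$ where each sum runs over one representative $\rho$ of each cut-Eulerian equivalence class.
   Context: $G=(V,E)$ is a finite graph, loops and multiple edges allowed; $c(\cdot)$ counts connected components; for $X\subseteq E$, $r(X)=|V|-c((V,X))$, $n(X)=|X|-r(X)$, and $r(G)=r(E)$. $R_G(x,y)=\sum_{X\subseteq E}x^{r(E)-r(X)}y^{n(X)}$. An orientation chooses for each edge one of its two directions (loops also have two); $\mathcal O(G)$ is the set of orientations; $E(\rho\ne\sigma)$ is the set of edges where they differ. An integer flow of $(G,\rho)$ is $g:E\to\mathbb Z$ with, at each vertex, sum over incoming edges equal to sum over outgoing edges; an integer tension is $f:E\to\mathbb Z$ with $f(e)=h(u)-h(v)$ for each edge directed from $u$ to $v$, for some $h:V\to\mathbb Z$. A directed circuit is a consistently oriented circuit; $C_\rho$ is the set of edges lying in some directed circuit of $(G,\rho)$. A bond is a minimal nonempty edge set $[S,V\setminus S]$, directed if all its edges point the same way across; a locally directed cut is an edge set $[S,V\setminus S]$ with an orientation making it a disjoint union of directed bonds; a directed Eulerian subgraph is an edge set with an orientation with equal in- and out-degree at every vertex. $\rho\sim_{ce}\sigma$ (cut-Eulerian equivalent) if $E(\rho\ne\sigma)$, oriented by $\rho$, is a disjoint union of a locally directed cut and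 a directed Eulerian subgraph (either possibly empty); this is an equivalence relation with set of classes $[\mathcal O(G)]$. For $\rho\in\mathcal O(G)$: $\kappa_\rho(G;p,q)$ ($p,q$ positive integers) is the number of pairs $(f,g)$ (integer tension, integer flow of $(G,\rho)$) with $f(e)g(e)=0$, $f(e)+g(e)>0$, $0\le f(e)<p$, $0\le g(e)<q$ for all $e$; $\bar\kappa_\rho(G;p,q)$ ($p,q$ nonnegative) is the number of such pairs with $0\le f(e)\le p$, $0\le g(e)\le q$ for all $e$; both agree with polynomials $\kappa_\rho(G;x,y)$, $\bar\kappa_\rho(G;x,y)$.
   Formalization: The closed count κ̄_ρ(G;p,q) is taken over pairs with f(e)g(e)=0 and 0≤f≤p, 0≤g≤q, without the condition f(e)+g(e)>0; with that condition the first identity fails (a single isthmus has R_G=x+1 but would give x). *)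

(* Defs.v *)
From HB Require Import structures.
From mathcomp Require Import boolp classical_sets.
From mathcomp Require Import all_boot all_order all_algebra.
Set Implicit Arguments.
Unset Strict Implicit.
Unset Printing Implicit Defensive.
Import GRing.Theory.
Local Open Scope set_scope.
Local Open Scope ring_scope.

(* The two ends of an edge are listed in an arbitrary order: this order only
   serves to name the two directions of the edge. Loops (equal ends) and
   multiple edges (same pair of ends) are allowed. *)
Record multigraph := Multigraph {
  vertex : finType;
  edge : finType;
  ends : edge -> vertex * vertex
}.

Section RankGeneratingPolynomial.
Variable G : multigraph.
Implicit Types X : {set edge G}.

Definition adjacent X : rel (vertex G) := fun u v =>
  [exists e in X, (ends e == (u, v)) || (ends e == (v, u))].

Definition components X : nat := n_comp (adjacent X) predT.

Definition rank X : nat := (#|vertex G| - components X)%N.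

Definition nullity X : nat := (#|X| - rank X)%N.

(* Bivariate polynomials follow polyXY: x is the outer variable 'X and y is
   the inner variable 'Y = 'X%:P. The truncated subtractions here and above
   are exact, since components X <= #|V|, rank X <= #|X| and
   rank X <= rank [set: edge G]. *)
Definition rank_gen_poly : {poly {poly rat}} :=
  \sum_(X : {set edge G}) 'X ^+ (rank [set: edge G] - rank X) * 'Y ^+ nullity X.

End RankGeneratingPolynomial.

(* P(-x, -y) *)
Definition negXY (P : {poly {poly rat}}) : {poly {poly rat}} :=
  map_poly (fun c : {poly rat} => c \Po (- 'X)) P \Po (- 'X).

(* rho e = false directs e from (ends e).1 to (ends e).2, and rho e = true the
   other way; in particular a loop has two directions. *)
Definition orientation (G : multigraph) := {ffun edge G -> bool}.

Section Orientations.
Variable G : multigraph.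
Implicit Types (rho sigma : orientation G) (A B : {set edge G}).

Definition tail rho (e : edge G) : vertex G :=
  if rho e then (ends e).2 else (ends e).1.
Definition head rho (e : edge G) : vertex G :=
  if rho e then (ends e).1 else (ends e).2.

Definition is_tension rho (f : edge G -> int) : Prop :=
  exists h : vertex G -> int, forall e, f e = h (tail rho e) - h (head rho e).

Definition is_flow rho (g : edge G -> int) : Prop :=
  forall v, \sum_(e | head rho e == v) g e = \sum_(e | tail rho e == v) g e.

(* A directed circuit is given by the cyclic sequence of its edges; requiring
   distinct tails makes both its vertices and its edges distinct. *)
Definition directed_circuit rho (c : seq (edge G)) : bool :=
  [&& c != [::],
      cycle (fun e1 e2 => head rho e1 == tail rho e2) c
    & uniq (map (tail rho) c)].

Definition circuit_edges rho : {set edge G} :=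
  [set e | `[< exists2 c, directed_circuit rho c & e \in c >]].

(* the edge set [S, V \ S] *)
Definition edge_cut (S : {set vertex G}) : {set edge G} :=
  [set e | ((ends e).1 \in S) != ((ends e).2 \in S)].

Definition is_cut B : bool := [exists S, B == edge_cut S].

Definition is_bond B : bool :=
  minset (fun A => is_cut A && (A != set0)) B.

Definition directed_bond rho B : bool :=
  is_bond B &&
  [exists S, (B == edge_cut S) && [forall e in B, tail rho e \in S]].

Definition locally_directed_cut rho B : bool :=
  is_cut B &&
  [exists D : {set {set edge G}},
    partition D B && [forall A in D, directed_bond rho A]].

Definition directed_eulerian rho A : bool :=
  [forall v, #|[set e in A | head rho e == v]|
             == #|[set e in A | tail rho e == v]|].

Definition diff_edges rho sigma : {set edge G} :=
  [set e | rho e != sigma e].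

Definition cut_eulerian_equiv rho sigma : bool :=
  [exists B : {set edge G}, exists A : {set edge G},
    [&& B :&: A == set0, B :|: A == diff_edges rho sigma,
        locally_directed_cut rho B & directed_eulerian rho A]].

Definition ce_classes : {set {set orientation G}} :=
  equivalence_partition cut_eulerian_equiv [set: orientation G].

(* The bounds 0 <= f(e) < p and 0 <= g(e) < q are carried by the ordinal types
   'I_p and 'I_q. *)
Definition kappa_count rho (p q : nat) : nat :=
  #|[set fg : {ffun edge G -> 'I_p} * {ffun edge G -> 'I_q} |
      `[< [/\ is_tension rho (fun e => (fg.1 e)%:Z),
              is_flow rho (fun e => (fg.2 e)%:Z)
            & forall e, (fg.1 e)%:Z * (fg.2 e)%:Z = 0
                        /\ 0 < (fg.1 e)%:Z + (fg.2 e)%:Z] >]]|.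

(* The closed version: the bounds become 0 <= f(e) <= p and 0 <= g(e) <= q,
   and f(e) + g(e) may vanish. *)
Definition kappa_bar_count rho (p q : nat) : nat :=
  #|[set fg : {ffun edge G -> 'I_p.+1} * {ffun edge G -> 'I_q.+1} |
      `[< [/\ is_tension rho (fun e => (fg.1 e)%:Z),
              is_flow rho (fun e => (fg.2 e)%:Z)
            & forall e, (fg.1 e)%:Z * (fg.2 e)%:Z = 0] >]]|.

(* Both polynomials are definite descriptions: at most one polynomial takes
   prescribed values at all pairs of positive integers, and one exists because
   the two counting functions are polynomial. The default 0 is never used. *)
Definition kappa rho : {poly {poly rat}} :=
  xget 0 (fun P : {poly {poly rat}} => forall p q : nat,
    (0 < p)%N -> (0 < q)%N -> P.[p%:R, q%:R] = (kappa_count rho p q)%:R).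

Definition kappa_bar rho : {poly {poly rat}} :=
  xget 0 (fun P : {poly {poly rat}} => forall p q : nat,
    P.[p%:R, q%:R] = (kappa_bar_count rho p q)%:R).

End Orientations.

(* Main.v *)
(* All edge functions are written in one reference orientation, and [sgn rho]
   passes to the coordinates of [rho].

   Tensions and flows are orthogonal, so [rho ~ sigma] holds exactly when
   (sgn rho - sgn sigma)/2 is the sum of an integer tension and an integer flow,
   the two supports being then automatically disjoint.

   Both lattices admit roundings: a point of [0, q]^E can be moved to {0, q}^E
   without changing its extreme coordinates. For a 0/1 point v of a face F of the
   polytope of such points in [0, 1]^E, the points of (q+1)F whose translate by
   -v leaves qF lie on smaller faces; inclusion-exclusion and induction make the
   counting functions polynomial.

   For p, q >= 2, R_G(p, q) counts the triples (x, w, X) with x a Z/p-tension, w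
   a Z/q-flow and supp w <= X <= E \ supp x. Fix integer lifts t of x and g of w
   with |t| < p and |g| < q, and orient each edge by the sign of t or g where
   one of them is nonzero, and according to X elsewhere. A pair (f, g') counted by
   kappa_bar for rho differs from (t, g) by p b and q a with b + a equal to
   (sgn rho - sgn sigma)/2, where sigma is the orientation so defined. Hence pairs
   for rho correspond to the triples whose orientation is equivalent to rho, and
   kappa counts the triples such that x and w have no common zero. The alternating
   sum of (-1)^|X| cancels on the triples with a common zero, which gives the
   second identity without Ehrhart reciprocity. *)
From mathcomp Require Import boolp classical_sets.
From mathcomp Require Import all_boot all_order all_algebra.
From mathcomp Require Import zify ring lra.
Require Import Defs.
Set Implicit Arguments.
Unset Strict Implicit.
Unset Printing Implicit Defensive.
Import Order.TTheory GRing.Theory Num.Theory.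
Local Open Scope ring_scope.

(** * Potentials, circulations and rounding *)

Section Potentials.
Variables (G : multigraph) (rho : orientation G).
Implicit Types (X : {set edge G}) (e : edge G).

Definition drop_along (R : zmodType) (h : vertex G -> R) e : R :=
  h (tail rho e) - h (head rho e).

(** Balance is expressed as orthogonality to all potential drops, so that a flow over any ring can
    be tested on a well-chosen potential. *)
Definition circulation (R : pzRingType) (g : edge G -> R) : Prop :=
  forall h : vertex G -> R, \sum_e g e * drop_along h e = 0.

Lemma adjacentP X u v : reflect
  (exists2 e, e \in X & (tail rho e, head rho e) = (u, v) \/
                        (tail rho e, head rho e) = (v, u))
  (adjacent X u v).
Proof.
rewrite /tail /head; apply: (iffP exists_inP) => -[e eX].
- case/orP => /eqP E; exists e => //; rewrite E /=; case: (rho e); by auto.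
- move=> H; exists e => //; move: H; case: (ends e) => a b /=.
  by case: (rho e) => -[] [-> ->]; rewrite eqxx ?orbT.
Qed.

Lemma adjacent_sym X : symmetric (adjacent X).
Proof.
by move=> u v; apply/exists_inP/exists_inP => -[e eX H]; exists e => //; rewrite orbC.
Qed.

Lemma connect_adjacent_sym X : connect_sym (adjacent X).
Proof. exact/sym_connect_sym/adjacent_sym. Qed.

Lemma connect_drop (R : zmodType) (h : vertex G -> R) X u v :
  {in X, forall e, drop_along h e = 0} -> connect (adjacent X) u v -> h u = h v.
Proof.
move=> hX /connectP [p + ->]; elim: p u => //= w p IH u /andP [/adjacentP [e eX E]].
move/IH <-; move: (hX e eX) => /eqP; rewrite subr_eq0 => /eqP.
by case: E => [[-> ->]|[-> ->]].
Qed.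

(** The signed edge count of a walk. Being integral it serves all rings at once: with one more edge
    it closes up to a circulation, over the rationals for rounding and over finite rings for
    counting. *)
Lemma walk_flow X u v : connect (adjacent X) u v ->
  exists2 z : edge G -> int, {in ~: X, forall e, z e = 0} &
  forall (R : pzRingType) (h : vertex G -> R),
    \sum_e (z e)%:~R * drop_along h e = h u - h v.
Proof.
case/connectP => p + ->; elim: p u => [|w p IH] u /=.
  move=> _; exists (fun=> 0) => // R h; rewrite subrr big1 // => e _.
  by rewrite mul0r.
case/andP => /adjacentP [e eX E] /IH [z z0 zE].
have [s sE] : exists s : int, forall (R : pzRingType) (h : vertex G -> R),
    s%:~R * drop_along h e = h u - h w.
  by case: E => [[E1 E2]|[E1 E2]]; [exists 1|exists (-1)] => R h;
    rewrite /drop_along E1 E2 ?mul1r ?mulN1r ?opprB.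
exists (fun e' => (if e' == e then s else 0) + z e') => [e'|R h].
  rewrite inE => He'; rewrite z0 ?inE // addr0; case: eqP He' => // ->.
  by rewrite eX.
under eq_bigr => e' _ do rewrite rmorphD mulrDl.
rewrite big_split /= zE (bigD1 e) //= eqxx sE big1 ?addr0 ?subrKA //.
by move=> e' /negPf ->; rewrite mul0r.
Qed.

Lemma comp_drop (R : pzRingType) X u : {in X, forall e,
  drop_along (fun v => (connect (adjacent X) u v)%:R : R) e = 0}.
Proof.
move=> e eX; rewrite /drop_along.
have E : connect (adjacent X) (tail rho e) (head rho e).
  by apply/connect1/adjacentP; exists e; auto.
by rewrite (same_connect_r (@connect_adjacent_sym X) E) subrr.
Qed.

End Potentials.

Section Rounding.
Variables (G : multigraph) (rho : orientation G).
Implicit Types (X : {set edge G}) (e : edge G).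

Lemma is_flowP (g : edge G -> int) : is_flow rho g <-> circulation rho g.
Proof.
have E h : \sum_e g e * drop_along rho h e =
    \sum_v (\sum_(e | tail rho e == v) g e - \sum_(e | head rho e == v) g e) * h v.
  under eq_bigr => e _ do rewrite /drop_along mulrBr.
  rewrite sumrB (partition_big (tail rho) predT) //=.
  rewrite [X in _ - X](partition_big (head rho) predT) //= -sumrB.
  apply: eq_bigr => v _; rewrite mulrBl !mulr_suml; congr (_ - _).
    by apply: eq_bigr => e /eqP ->.
  by apply: eq_bigr => e /eqP ->.
split=> [fl h|ci v].
  by rewrite E big1 // => v _; rewrite fl subrr mul0r.
have := ci (fun u => (u == v)%:R); rewrite E (bigD1 v) //= eqxx mulr1 [X in _ + X]big1 ?addr0.
  by move/eqP; rewrite subr_eq0 => /eqP.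
by move=> u /negPf ->; rewrite mulr0.
Qed.

Definition fractional (x : edge G -> rat) : {set edge G} := [set e | 0 < x e < 1].

(* Otherwise the sum of [x] over the cut around one end of [e] would be the sum
   of [x e] and of integers. *)
Lemma fractional_cyclic (x : edge G -> rat) e :
    (forall e, 0 <= x e <= 1) ->
    (forall h : vertex G -> int,
       \sum_e x e * (drop_along rho h e)%:~R \is a Num.int) ->
    e \in fractional x ->
  connect (adjacent (fractional x :\ e)) (tail rho e) (head rho e).
Proof.
move=> x01 xint; rewrite inE => /andP [x0 x1]; apply/negPn/negP => nc.
set X := fractional x :\ e.
have := xint (fun v => (connect (adjacent X) (tail rho e) v)%:R).
rewrite (bigD1 e) //= {1}/drop_along connect0 (negPf nc) subr0 mulr1.
rewrite rpredDr ?rpred_sum //; last first.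
  move=> e' ne; case: (boolP (e' \in X)) => e'X.
    by rewrite comp_drop // mulr0.
  apply: rpredM; last exact: intr_int.
  move: e'X (x01 e'); rewrite !inE ne /= negb_and -!leNgt.
  case/orP => [l0|l1] /andP [g0 g1].
    by have -> : x e' = 0 by apply/eqP; rewrite eq_le l0.
  by have -> : x e' = 1 by apply/eqP; rewrite eq_le g1.
case/intrP => k xk; move: x0 x1; rewrite xk ltr0z ltrz1; lia.
Qed.

(** Moving along [z] until the first coordinate of its support reaches 0 or 1 makes that coordinate
    tight and leaves the tight ones fixed. *)
Lemma push_tight (x z : edge G -> rat) :
    (forall e, 0 <= x e <= 1) -> (forall e, e \notin fractional x -> z e = 0) ->
    (exists e, z e != 0) ->
  exists2 t, (forall e, 0 <= x e + t * z e <= 1) &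
    fractional (fun e => x e + t * z e) \proper fractional x.
Proof.
move=> x01 zsupp [e1 ze1].
(* [r e] is the step length at which coordinate [e] hits the bound towards which [z] drives it; the
   least one is taken. *)
pose r e := if 0 < z e then (1 - x e) / z e else x e / - z e.
case: (@arg_minP _ _ _ e1 (fun e => z e != 0) r ze1) => e0 ze0 min.
have xf e : z e != 0 -> 0 < x e < 1.
  move=> ze; suff: e \in fractional x by rewrite inE.
  by apply: contraNT ze => /zsupp ->.
have r0 e : z e != 0 -> 0 < r e.
  move=> ze; rewrite /r; case/andP: (xf e ze) => a b.
  case: (ltP 0 (z _)) => zz; first by rewrite divr_gt0 // subr_gt0.
  by rewrite divr_gt0 // oppr_gt0 lt_neqAle ze.
have t0 := r0 _ ze0.
have bnd e : z e != 0 -> 0 <= x e + r e0 * z e <= 1.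
  move=> ze; have := min e ze; have := xf e ze; rewrite {2}/r.
  case: (ltP 0 (z _)) => zz xb.
    rewrite ler_pdivlMr // => le; have := mulr_ge0 (ltW t0) (ltW zz).
    by apply: (fun P => P); lra.
  have zn : 0 < - z e by rewrite oppr_gt0 lt_neqAle ze.
  rewrite ler_pdivlMr // mulrN => le; have := mulr_ge0 (ltW t0) (ltW zn).
  by rewrite mulrN => ?; lra.
exists (r e0).
  move=> e; case: (eqVneq (z e) 0) => [->|/bnd //]; by rewrite mulr0 addr0.
apply/properP; split.
  apply/subsetP => e; rewrite inE; case: (eqVneq (z e) 0) => [->|/xf].
    by rewrite mulr0 addr0 inE.
  by rewrite inE.
exists e0; first by rewrite inE xf.
rewrite inE /r; case: (ltP 0 (z _)) => zz.
  by rewrite divfK // addrC subrK ltxx andbF.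
by rewrite invrN mulrN mulNr divfK // subrr ltxx.
Qed.

(** A fractional edge always closes a walk of fractional edges. Pushing along this closed walk
    preserves all sums against integer potentials, keeps extreme coordinates and lowers the number
    of fractional edges. *)
Lemma circulation_rounding (x : edge G -> rat) :
    (forall e, 0 <= x e <= 1) ->
    (forall h : vertex G -> int,
       \sum_e x e * (drop_along rho h e)%:~R \is a Num.int) ->
  exists y : edge G -> bool,
    [/\ forall h : vertex G -> int,
          \sum_e ((y e)%:R - x e) * (drop_along rho h e)%:~R = 0,
        forall e, x e = 0 -> y e = false & forall e, x e = 1 -> y e = true].
Proof.
elim: {x}_.+1 {-2}x (ltnSn #|fractional x|) => // n IH x; rewrite ltnS => le x01 xint.
case: (set_0Vmem (fractional x)) => [f0|[e ef]].
  have xE e : x e = (x e == 1)%:R.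
    case: eqP => //= /eqP x1; apply/eqP; move/setP/(_ e): f0; rewrite !inE.
    have /andP [g0 g1] := x01 e.
    by rewrite !lt_neqAle g0 g1 x1 !andbT => /negbFE; rewrite eq_sym.
  exists (fun e => x e == 1); split=> [h|e ->|e ->]; rewrite ?eqxx //.
    by rewrite big1 // => e _; rewrite -xE subrr mul0r.
have [z z0 zE] := walk_flow rho (fractional_cyclic x01 xint ef).
pose w e' : rat := (e' == e)%:R - (z e')%:~R.
have wE (h : vertex G -> int) : \sum_e' w e' * (drop_along rho h e')%:~R = 0.
  under eq_bigr => e' _ do rewrite mulrBl.
  rewrite sumrB (bigD1 e) //= eqxx mul1r big1 => [|e' /negPf ->]; rewrite ?mul0r //.
  have -> : \sum_e' (z e')%:~R * (drop_along rho h e')%:~R =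
    \sum_e' (z e')%:~R * drop_along rho (fun v => (h v)%:~R : rat) e'.
    by apply: eq_bigr => e' _; rewrite /drop_along intrB.
  by rewrite zE /drop_along intrB addr0 subrr.
have [||t x'01 prop] := @push_tight x w x01.
- move=> e' e'f; rewrite /w z0 ?subr0 ?inE.
    by case: eqP e'f => // ->; rewrite ef.
  by move: e'f; rewrite !inE => /negPf ->; rewrite andbF.
- by exists e; rewrite /w eqxx z0 ?inE ?eqxx // subr0 oner_eq0.
have sumE (h : vertex G -> int) :
    \sum_e (x e + t * w e) * (drop_along rho h e)%:~R =
    \sum_e x e * (drop_along rho h e)%:~R.
  under eq_bigr => e' _ do rewrite mulrDl -mulrA.
  by rewrite big_split /= -mulr_sumr wE mulr0 addr0.
have [|//||y [yE y0 y1]] := IH (fun e => x e + t * w e).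
- exact: leq_trans (proper_card prop) le.
- by move=> h; rewrite sumE.
have w0 e' : e' \notin fractional x -> w e' = 0.
  move=> e'f; rewrite /w z0 ?subr0 ?inE.
    by case: eqP e'f => // ->; rewrite ef.
  by move: e'f; rewrite !inE => /negPf ->; rewrite andbF.
exists y; split=> [h|e' E|e' E].
- have := yE h; under eq_bigr => e' _ do rewrite mulrBl.
  rewrite sumrB sumE => E.
  by under eq_bigr => e' _ do rewrite mulrBl; rewrite sumrB.
- by apply: y0; rewrite w0 ?inE E ?ltxx // mulr0 addr0.
- by apply: y1; rewrite w0 ?inE E ?ltxx ?andbF // mulr0 addr0.
Qed.

End Rounding.

(** * Counting lattice points of faces *)

Lemma card_bij (T U : finType) (A : {set T}) (B : {set U}) (f : T -> U) (g : U -> T) :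
    (forall x, x \in A -> f x \in B) -> (forall y, y \in B -> g y \in A) ->
    {in A, cancel f g} -> {in B, cancel g f} ->
  #|A| = #|B|.
Proof.
move=> fA gB fK gK; rewrite -(card_in_imset (can_in_inj fK)).
congr #|pred_of_set _|; apply/setP => y; apply/imsetP/idP => [[x xA ->]|yB].
  exact: fA.
by exists (g y); rewrite ?gK ?gB.
Qed.

(** Expanding (q+1)^(n+1) - q^(n+1) gives (n+1) q^n plus lower powers, whose antidifferences come
    from the induction. *)
Lemma antidifference_monomial n : exists Q : {poly rat}, forall q : nat,
  Q.[q.+1%:R] - Q.[q%:R] = q%:R ^+ n.
Proof.
elim/ltn_ind: n => n IH.
have /fin_all_exists [Q QE] : forall k : 'I_n, exists Q : {poly rat},
    forall q : nat, Q.[q.+1%:R] - Q.[q%:R] = q%:R ^+ k by move=> k; apply: IH.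
pose P := 'X^(n.+1) - \sum_(k < n) 'C(n.+1, k)%:R *: Q k.
have PE (q : nat) : P.[q.+1%:R] - P.[q%:R] = n.+1%:R * q%:R ^+ n.
  have aux (a b c d : rat) : (a - b) - (c - d) = (a - c) - (b - d) by ring.
  rewrite /P !hornerD !hornerN !horner_sum !hornerXn aux -sumrB.
  have -> : \sum_(k < n) (('C(n.+1, k)%:R *: Q k).[q.+1%:R] -
                          ('C(n.+1, k)%:R *: Q k).[q%:R]) =
            \sum_(k < n) q%:R ^+ k *+ 'C(n.+1, k) :> rat.
    apply: eq_bigr => k _; rewrite !hornerZ -mulrBr QE mulr_natl //.
  rewrite -[q.+1]add1n natrD exprDn big_ord_recr big_ord_recr /= binn subnn binSn.
  under eq_bigr => i _ do rewrite expr1n mul1r.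
  rewrite !expr1n !mul1r mulr1n mulr_natl; ring.
exists (n.+1%:R^-1 *: P) => q.
by rewrite !hornerZ -mulrBr PE mulKf // pnatr_eq0.
Qed.

Lemma antidifference (P : {poly rat}) : exists Q : {poly rat}, forall q : nat,
  Q.[q.+1%:R] - Q.[q%:R] = P.[q%:R].
Proof.
have [Q QE] := fin_all_exists (fun k : 'I_(size P) => antidifference_monomial k).
exists (\sum_(k < size P) P`_k *: Q k) => q.
rewrite !horner_sum -sumrB horner_coef; apply: eq_bigr => k _.
by rewrite !hornerZ -mulrBr QE.
Qed.

(** The threshold is 0 or 1: at q = 0 the extreme values 0 and q coincide, and counts with
    prescribed or excluded extremes may deviate from their polynomial there. *)
Definition poly_from (n : nat) (f : nat -> nat) : Prop :=
  exists P : {poly rat}, forall q, (n <= q)%N -> P.[q%:R] = (f q)%:R.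

Lemma poly_from_diff n f g h : (forall q, (n <= q)%N -> f q = g q + h q)%N ->
  poly_from n f -> poly_from n h -> poly_from n g.
Proof.
move=> E [P PE] [Q QE]; exists (P - Q) => q nq.
by rewrite hornerD hornerN PE // QE // E // natrD addrK.
Qed.

Lemma poly_from_sum f g : poly_from 1 g ->
  (forall q, f q.+1 = f q + g q.+1)%N -> poly_from 0 f.
Proof.
(* The shift is by 1 because the increment from q to q+1 is [g] at q+1; thus [g] is only evaluated
   from 1 on. *)
move=> [P PE] E; have [Q QE] := antidifference (P \Po ('X + 1)).
exists (Q + ((f 0)%:R - Q.[0])%:P) => q _.
rewrite hornerD hornerC; elim: q => [|q IH]; first by rewrite addrC subrK.
rewrite E natrD -IH -[Q.[q.+1%:R]](subrK Q.[q%:R]) QE horner_comp hornerD hornerX hornerC.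
by rewrite natr1 PE //; ring.
Qed.

Section Ehrhart.
Variables (E : finType) (L : (E -> int) -> Prop).
Hypothesis L0 : L (fun=> 0).
Hypothesis LD : forall x y, L x -> L y -> L (fun e => x e + y e).
Hypothesis LB : forall x y, L x -> L y -> L (fun e => x e - y e).
Hypothesis Lround : forall q x, (0 < q)%N -> L x -> (forall e, 0 <= x e <= q%:Z) ->
  exists y : E -> bool, [/\ L (fun e => (y e)%:Z),
    forall e, x e = 0 -> y e = false & forall e, x e = q%:Z -> y e = true].

(* [c.2] selects which of the two extreme values [0] and [q] is meant. *)
Definition extremal q (x : {ffun E -> 'I_q.+1}) (c : E * bool) : bool :=
  (x c.1 == (c.2 * q)%N :> nat).

(** [K] lists facets of the dilated cube that contain the points, [D] facets that are removed. *)
Definition face q (K D : seq (E * bool)) : {set {ffun E -> 'I_q.+1}} :=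
  [set x : {ffun E -> 'I_q.+1} | [&& `[< L (fun e => (x e)%:Z) >], all (extremal x) K
             & all (predC (extremal x)) D]].

Lemma card_face_cons q K D c :
  #|face q K D| = (#|face q K (c :: D)| + #|face q (c :: K) D|)%N.
Proof.
rewrite -(cardsID [set x | extremal x c]) addnC; congr (_ + _)%N; congr #|pred_of_set _|;
  apply/setP => x; rewrite !inE /=; case: asboolP => //= _;
  by case: (extremal x c); rewrite /= ?andbT ?andbF.
Qed.

(** Translation by [v] sends qF onto the points of (q+1)F that avoid, off [K], the extreme value
    opposite to [v]: q+1 where [v] is 0, and 0 where [v] is 1. *)
Lemma card_face_shift q K (v : E -> bool) : L (fun e => (v e)%:Z) ->
    all (fun c => v c.1 == c.2) K ->
  #|face q K [::]| =
  #|face q.+1 K [seq (e, ~~ v e) | e <- enum (predC [in map fst K])]|.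
Proof.
move=> Lv vK.
pose f (x : {ffun E -> 'I_q.+1}) : {ffun E -> 'I_q.+2} := [ffun e => inord (x e + v e)].
pose g (x : {ffun E -> 'I_q.+2}) : {ffun E -> 'I_q.+1} := [ffun e => inord (x e - v e)].
have fE x e : f x e = (x e + v e)%N :> nat.
  by rewrite ffunE inordK //; have := ltn_ord (x e); case: (v e); lia.
have gP x : x \in face q.+1 K [seq (e, ~~ v e) | e <- enum (predC [in map fst K])] ->
    forall e, (x e - v e <= q)%N /\ (v e <= x e)%N.
  rewrite inE => /and3P [_ /allP xK /allP xD] e.
  case: (boolP (e \in map fst K)) => [/mapP [c cK ->]|eK].
    move: (xK c cK) (allP vK c cK); rewrite /extremal => /eqP -> /eqP ->.
    by case: c.2; lia.
  have : (e, ~~ v e) \in [seq (e, ~~ v e) | e <- enum (predC [in map fst K])].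
    by apply: map_f; rewrite mem_enum inE.
  by move/xD; rewrite /extremal /=; have := ltn_ord (x e); case: (v e) => /=; lia.
have gE x e : x \in face q.+1 K [seq (e, ~~ v e) | e <- enum (predC [in map fst K])] ->
    g x e = (x e - v e)%N :> nat.
  by move/gP/(_ e) => [H _]; rewrite ffunE inordK.
apply: (@card_bij _ _ _ _ f g).
- move=> x; rewrite !inE => /and3P [/asboolP Lx /allP xK _]; apply/and3P; split.
  + apply/asboolP; have -> : (fun e => (f x e)%:Z) = (fun e => (x e)%:Z + (v e)%:Z).
      by apply/funext => e; rewrite fE PoszD.
    exact: LD.
  + apply/allP => c cK; move: (xK c cK) (allP vK c cK); rewrite /extremal fE.
    by move=> /eqP -> /eqP ->; case: c.2; lia.
  + apply/allP => c /mapP [e _ ->]; rewrite /extremal /= fE.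
    by have := ltn_ord (x e); case: (v e) => /=; lia.
- move=> x xF; have := xF; rewrite !inE => /and3P [/asboolP Lx /allP xK _].
  rewrite andbT; apply/andP; split.
  + apply/asboolP; have -> : (fun e => (g x e)%:Z) = (fun e => (x e)%:Z - (v e)%:Z).
      by apply/funext => e; rewrite gE // subzn //; case: (gP _ xF e).
    exact: LB.
  + apply/allP => c cK; move: (xK c cK) (allP vK c cK); rewrite /extremal gE //.
    by move=> /eqP -> /eqP ->; case: c.2; lia.
- move=> x xF; apply/ffunP => e; apply/val_inj; rewrite /= ffunE fE addnK inordK //.
- move=> x xF; apply/ffunP => e; apply/val_inj; rewrite /= fE gE // subnK //.
  by case: (gP _ xF e).
Qed.

(** Inclusion-exclusion, one removed facet at a time; the faces [K' ++ K] are the intersections that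
    occur. *)
Lemma face_poly_excl K : (forall K', poly_from 1 (fun q => #|face q (K' ++ K) [::]|)) ->
  forall D, poly_from 1 (fun q => #|face q K D|).
Proof.
move=> HK D; elim: D K HK => [|c D IH] K HK; first exact: (HK [::]).
apply: (poly_from_diff (f := fun q => #|face q K D|)
          (h := fun q => #|face q (c :: K) D|)) => [q _||].
- exact: card_face_cons.
- exact: IH.
- by apply: IH => K'; rewrite -cat_rcons; apply: HK.
Qed.

(** Induction on the number of coordinates that [K] leaves free. If the face has a 0/1 point [v],
    translation by [v] shows that the count grows from q to q+1 by points on smaller faces. If it
    has none, rounding shows that it is empty for q > 0; at q = 0 it still holds the zero point,
    whence the two thresholds. *)
Lemma face_poly K :
  poly_from 1 (fun q => #|face q K [::]|) /\
  ((exists2 v : E -> bool, L (fun e => (v e)%:Z) & all (fun c => v c.1 == c.2) K) ->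
   poly_from 0 (fun q => #|face q K [::]|)).
Proof.
have [n] := ubnP #|predC [in map fst K]|; elim: n K => // n IH K; rewrite ltnS => leK.
suff H : (exists2 v : E -> bool, L (fun e => (v e)%:Z) & all (fun c => v c.1 == c.2) K) ->
    poly_from 0 (fun q => #|face q K [::]|).
  split=> //.
  case: (pselect (exists2 v : E -> bool, L (fun e => (v e)%:Z) &
           all (fun c => v c.1 == c.2) K)) => [/H [P PE]|nv].
    by exists P => q _; apply: PE.
  exists 0 => q q0; rewrite horner0 (_ : face q K [::] = set0) ?cards0 //.
  apply/setP => x; rewrite !inE andbT; apply/negP => /andP [/asboolP Lx /allP xK].
  case: nv; have [|y [Ly y0 y1]] := Lround q0 Lx.
    by move=> e /=; rewrite !lez_nat -ltnS ltn_ord.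
  exists y => //; apply/allP => -[e b] /xK; rewrite /extremal /= => /eqP xe.
  by apply/eqP; case: b xe => /= xe; [apply: y1 | apply: y0]; rewrite xe ?mul1n ?mul0n.
move=> [v Lv vK].
set D := [seq (e, ~~ v e) | e <- enum (predC [in map fst K])].
suff excl : forall D', {subset D' <= D} ->
    exists2 g, poly_from 1 g & forall q, #|face q K [::]| = (#|face q K D'| + g q)%N.
  have [//|g gP gE] := excl D.
  by apply: (poly_from_sum gP) => q; rewrite gE (card_face_shift q Lv vK).
elim=> [_|c D' IHD sub].
  by exists (fun=> 0%N) => [|q]; [exists 0 => q _; rewrite horner0 | rewrite addn0].
have [|g gP gE] := IHD; first by move=> c' c'D; apply: sub; rewrite inE c'D orbT.
have cD : c \in D by apply: sub; rewrite mem_head.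
have [P PE] : poly_from 1 (fun q => #|face q (c :: K) D'|).
  apply: face_poly_excl => K'; apply: (IH _ _).1; apply: leq_trans leK.
  apply: proper_card; apply/properP; split.
    apply/subsetP => e; rewrite !inE /= !map_cat /= mem_cat inE !negb_or.
    by case/and3P.
  case/mapP: cD => e; rewrite mem_enum => eK ->; exists e => //.
  by rewrite !inE map_cat /= mem_cat inE eqxx orbT.
case: gP => Q QE; exists (fun q => #|face q (c :: K) D'| + g q)%N.
  by exists (P + Q) => q q0; rewrite hornerD natrD PE // QE.
by move=> q; rewrite gE (card_face_cons q K D' c) addnA.
Qed.

Lemma face_poly0 : poly_from 0 (fun q => #|face q [::] [::]|).
Proof. by apply: (face_poly [::]).2; exists (fun=> false). Qed.

Lemma face_poly1 K D : poly_from 1 (fun q => #|face q K D|).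
Proof. by apply: face_poly_excl => K'; case: (face_poly (K' ++ K)). Qed.

End Ehrhart.

(** * Integer tensions and flows of an oriented graph *)

Section TensionsFlows.
Variables (G : multigraph) (rho : orientation G).
Implicit Types (e : edge G) (f g x : edge G -> int).

Lemma tension0 : is_tension rho (fun=> 0).
Proof. by exists (fun=> 0) => e; rewrite subrr. Qed.

Lemma tensionB f1 f2 : is_tension rho f1 -> is_tension rho f2 ->
  is_tension rho (fun e => f1 e - f2 e).
Proof.
by move=> [h1 E1] [h2 E2]; exists (fun v => h1 v - h2 v) => e; rewrite E1 E2; ring.
Qed.

Lemma tensionN f : is_tension rho f -> is_tension rho (fun e => - f e).
Proof. by move=> [h E]; exists (fun v => - h v) => e; rewrite E; ring. Qed.

Lemma tensionD f1 f2 : is_tension rho f1 -> is_tension rho f2 ->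
  is_tension rho (fun e => f1 e + f2 e).
Proof.
by move=> [h1 E1] [h2 E2]; exists (fun v => h1 v + h2 v) => e; rewrite E1 E2; ring.
Qed.

(** The potentials at the two ends of an edge are congruent modulo [q], so integer division of the
    potential by [q] divides every drop exactly. *)
Lemma tension_cancel q f : (0 < q)%N ->
  is_tension rho (fun e => q%:Z * f e) -> is_tension rho f.
Proof.
move=> q0 [h E]; exists (fun v => (h v %/ q%:Z)%Z) => e.
have -> : h (tail rho e) = f e * q%:Z + h (head rho e) by rewrite mulrC E subrK.
by rewrite divzMDl ?addrK //; lia.
Qed.

Lemma flow0 : is_flow rho (fun=> 0).
Proof. by apply/is_flowP => h; rewrite big1 // => e _; rewrite mul0r. Qed.

Lemma flowD g1 g2 : is_flow rho g1 -> is_flow rho g2 ->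
  is_flow rho (fun e => g1 e + g2 e).
Proof.
move=> /is_flowP E1 /is_flowP E2; apply/is_flowP => h.
by under eq_bigr do rewrite mulrDl; rewrite big_split /= E1 E2 addr0.
Qed.

Lemma flowN g : is_flow rho g -> is_flow rho (fun e => - g e).
Proof.
move=> /is_flowP E; apply/is_flowP => h.
by under eq_bigr do rewrite mulNr; rewrite sumrN E oppr0.
Qed.

Lemma flowB g1 g2 : is_flow rho g1 -> is_flow rho g2 ->
  is_flow rho (fun e => g1 e - g2 e).
Proof. by move=> E1 E2; apply: flowD => //; apply: flowN. Qed.

Lemma flow_cancel q g : (0 < q)%N ->
  is_flow rho (fun e => q%:Z * g e) -> is_flow rho g.
Proof.
move=> q0 /is_flowP E; apply/is_flowP => h; apply/eqP; have /eqP := E h.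
under eq_bigr do rewrite -mulrA; rewrite -mulr_sumr mulf_eq0.
by case/orP => //; lia.
Qed.

Lemma tension_flow_orth f g : is_tension rho f -> is_flow rho g ->
  \sum_e f e * g e = 0.
Proof.
move=> [h E] /is_flowP ci; rewrite -[RHS](ci h).
by apply: eq_bigr => e _; rewrite E mulrC.
Qed.

(** By orthogonality these nonnegative terms sum to 0. This sign argument is the source of the
    disjoint supports below. *)
Lemma tension_flow_eq0 f g : is_tension rho f -> is_flow rho g ->
  (forall e, 0 <= f e * g e) -> forall e, f e * g e = 0.
Proof.
move=> tf fg nn e; have /eqP := tension_flow_orth tf fg.
by rewrite psumr_eq0 // => /allP /(_ e (mem_index_enum _)) /eqP.
Qed.

(** The new potential is [h] divided by [q] and rounded down. Residues differ by less than [q], so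
    drops between 0 and [q] become 0 or 1, with 0 going to 0 and [q] to 1. *)
Lemma tension_rounding q f : (0 < q)%N -> is_tension rho f ->
    (forall e, 0 <= f e <= q%:Z) ->
  exists y : edge G -> bool, [/\ is_tension rho (fun e => (y e)%:Z),
    forall e, f e = 0 -> y e = false & forall e, f e = q%:Z -> y e = true].
Proof.
move=> q0 [h E] bnd.
pose d e := (h (tail rho e) %/ q%:Z)%Z - (h (head rho e) %/ q%:Z)%Z.
have q0' : 0 < q%:Z by lia.
have dE e : f e = d e * q%:Z + ((h (tail rho e) %% q%:Z)%Z - (h (head rho e) %% q%:Z)%Z).
  by rewrite E {1}(divz_eq (h (tail rho e)) q) {1}(divz_eq (h (head rho e)) q) /d; ring.
have md v : 0 <= (h v %% q%:Z)%Z < q%:Z by rewrite modz_ge0 ?ltz_pmod // lt0r_neq0.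
have dP e : [/\ d e = (d e == 1)%:Z, f e = 0 -> d e = 0 & f e = q%:Z -> d e = 1].
  move: (dE e) (bnd e) (md (tail rho e)) (md (head rho e)).
  set a := (_ %% _)%Z; set b := (_ %% _)%Z; move: (d e) => D -> B A1 A2.
  have [D0|[D0|D0]] : D <= -1 \/ 1 < D \/ (D = 0 \/ D = 1) by lia.
  - by exfalso; nia.
  - by exfalso; nia.
  - by case: D0 => ->; split=> //; lia.
exists (fun e => d e == 1); split.
- exists (fun v => (h v %/ q%:Z)%Z) => e; by case: (dP e) => <-.
- by move=> e; case: (dP e) => _ H _ /H ->.
- by move=> e; case: (dP e) => _ _ H /H ->.
Qed.

(** Divided by [q], [x] has integer sums against integer potentials, which is all that rational
    rounding asks for. The congruence form covers both integer flows and representatives of flows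
    modulo [q]. *)
Lemma flow_rounding_mod q x : (0 < q)%N -> (forall e, 0 <= x e <= q%:Z) ->
    (forall h : vertex G -> int, (q%:Z %| \sum_e x e * drop_along rho h e)%Z) ->
  exists y : edge G -> bool, [/\ is_flow rho (fun e => x e - q%:Z * (y e)%:Z),
    forall e, x e = 0 -> y e = false & forall e, x e = q%:Z -> y e = true].
Proof.
move=> q0 bnd dvd.
have q0' : (0 : rat) < q%:R by rewrite ltr0n.
have qn0 : (q%:R : rat) != 0 by rewrite lt0r_neq0.
have [||y [yE y0 y1]] := @circulation_rounding G rho (fun e => (x e)%:~R / q%:R).
- move=> e; have /andP [b0 b1] := bnd e.
  rewrite divr_ge0 ?ler0z ?ler0n // ler_pdivrMr // mul1r.
  by rewrite -(ler_int rat) in b1.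
- move=> h; have /dvdzP [k kE] := dvd h.
  have -> : \sum_e (x e)%:~R / q%:R * (drop_along rho h e)%:~R = k%:~R :> rat.
    apply: (mulIf qn0); rewrite mulr_suml.
    have := congr1 (fun z : int => z%:~R : rat) kE; rewrite /= rmorphM /= => <-.
    rewrite rmorph_sum; apply: eq_bigr => e _.
    by rewrite rmorphM /= mulrAC divfK.
  exact: intr_int.
exists y; split.
- apply/is_flowP => h; apply/eqP; rewrite -(intr_eq0 rat) rmorph_sum /=.
  have := yE h => /(congr1 (fun z => - q%:R * z)); rewrite mulr0 => E.
  rewrite -[0 in X in _ == X]E mulr_sumr; apply/eqP/eq_bigr => e _.
  rewrite rmorphM /= rmorphB /= rmorphM /= mulrA; congr (_ * _).
  rewrite mulNr mulrBr opprB mulrCA divff // mulr1.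
  by case: (y e).
- by move=> e xe; apply: y0; rewrite xe mul0r.
- by move=> e xe; apply: y1; rewrite xe divff.
Qed.

Lemma flow_rounding q g : (0 < q)%N -> is_flow rho g ->
    (forall e, 0 <= g e <= q%:Z) ->
  exists y : edge G -> bool, [/\ is_flow rho (fun e => (y e)%:Z),
    forall e, g e = 0 -> y e = false & forall e, g e = q%:Z -> y e = true].
Proof.
move=> q0 fg bnd; have [|y [yf y0 y1]] := flow_rounding_mod q0 bnd.
  by move=> h; have /is_flowP -> := fg; rewrite dvdz0.
exists y; split=> //; apply: (flow_cancel q0).
have -> : (fun e => q%:Z * (y e)%:Z) = (fun e => g e - (g e - q%:Z * (y e)%:Z)).
  by apply/funext => e; rewrite opprB addrC subrK.
exact: flowB.
Qed.

(* The edges leaving the set of vertices reachable from the head of [e] do not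
   exist, so positivity of the flow on [e] would violate its balance there. *)
Lemma positive_flow_circuit g e : is_flow rho g -> (forall e, 0 <= g e) -> 0 < g e ->
  e \in circuit_edges rho.
Proof.
move=> /is_flowP fl g0 ge0.
pose d := [rel u v : vertex G | [exists e, (tail rho e == u) && (head rho e == v)]].
have step e' : d (tail rho e') (head rho e') by apply/existsP; exists e'; rewrite !eqxx.
have conn : connect d (head rho e) (tail rho e).
  apply/negPn/negP => nc.
  have /eqP := fl (fun v => - (connect d (head rho e) v)%:R).
  rewrite psumr_eq0 => [/allP /(_ e (mem_index_enum _))|e' _].
    by rewrite /drop_along connect0 (negPf nc) /= sub0r opprK mulr1; lia.
  apply: mulr_ge0 => //; rewrite /drop_along opprK.
  case: (boolP (connect d _ (tail rho e'))) => [c|_].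
    by rewrite (connect_trans c (connect1 (step e'))).
  by rewrite oppr0 add0r; case: connect.
have lift p v0 e0 : head rho e0 = v0 -> path d v0 p -> exists s,
    [/\ path (fun e1 e2 => head rho e1 == tail rho e2) e0 s,
        map (tail rho) s = belast v0 p & head rho (last e0 s) = last v0 p].
  elim: p v0 e0 => [|w p IH] v0 e0 E0 /=; first by exists [::].
  case/andP => /existsP [e1 /andP [/eqP t1 /eqP h1]] /(IH w e1 h1) [s [s1 s2 s3]].
  by exists (e1 :: s); rewrite /= s1 s2 s3 t1 E0 eqxx.
(* Shortening the vertex path makes the tails of the lifted edges distinct. *)
case/connectP: conn => p0 pd0 pl0; move: pl0; case/shortenP: pd0 => p pd pu _ pl.
have [s [s1 s2 s3]] := lift p _ e erefl pd.
rewrite inE; apply/asboolP; exists (e :: s); last exact: mem_head.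
rewrite /directed_circuit /= rcons_path s1 s3 -pl eqxx /= s2 pl.
by rewrite -rcons_uniq -lastI.
Qed.

(** Around a directed circuit the drops telescope to 0, and none of them is negative. *)
Lemma circuit_tension_eq0 f e : is_tension rho f -> (forall e, 0 <= f e) ->
  e \in circuit_edges rho -> f e = 0.
Proof.
move=> [h E] f0; rewrite inE => /asboolP [c /and3P [c0 cyc _] ec].
have tele e0 s : path (fun e1 e2 => head rho e1 == tail rho e2) e0 s ->
    \sum_(e' <- e0 :: s) f e' = h (tail rho e0) - h (head rho (last e0 s)).
  elim: s e0 => [|e1 s IH] e0 /=; first by rewrite big_seq1 E.
  by case/andP => /eqP E1 /IH; rewrite big_cons => ->; rewrite E E1 subrKA.
case: c c0 cyc ec => // e0 s _ /=; rewrite rcons_path => /andP [/tele sE /eqP hE] es.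
move/eqP: sE; rewrite hE subrr psumr_eq0 // => /allP /(_ e es).
by move/eqP.
Qed.

End TensionsFlows.

(** * Cut-Eulerian equivalence *)

Section CutEulerian.
Variable G : multigraph.
Implicit Types (e : edge G) (rho sigma tau : orientation G) (A B : {set edge G}).

Lemma edge_cutE rho (S : {set vertex G}) e :
  (e \in edge_cut S) = ((tail rho e \in S) != (head rho e \in S)).
Proof. by rewrite inE /tail /head; case: (rho e) => //; rewrite eq_sym. Qed.

Lemma cut_tension rho (S : {set vertex G}) :
  is_tension rho (fun e => (tail rho e \in S)%:Z - (head rho e \in S)%:Z).
Proof. by exists (fun v => (v \in S)%:Z). Qed.

Lemma directed_eulerianP rho A :
  reflect (is_flow rho (fun e => (e \in A)%:Z)) (directed_eulerian rho A).
Proof.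
have E (t : edge G -> vertex G) v :
    \sum_(e | t e == v) (e \in A)%:Z = (#|[set e in A | t e == v]|)%:Z.
  rewrite -sum1_card rmorph_sum big_mkcond [RHS]big_mkcond; apply: eq_bigr => e _.
  by rewrite inE andbC; case: (t e == v); case: (e \in A).
apply: (iffP forallP) => H v; first by rewrite !E (eqP (H v)).
by apply/eqP; move: (H v); rewrite !E => -[].
Qed.

Lemma directed_bond_tension rho A :
  directed_bond rho A -> is_tension rho (fun e => (e \in A)%:Z).
Proof.
case/andP => _ /existsP [S /andP [/eqP AE /forall_inP tS]].
have -> : (fun e => (e \in A)%:Z) =
    (fun e => (tail rho e \in S)%:Z - (head rho e \in S)%:Z).
  apply/funext => e; move: (tS e); rewrite AE (edge_cutE rho).
  by case: (tail rho e \in S); case: (head rho e \in S) => // /(_ isT).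
exact: cut_tension.
Qed.

(* If a cut [A'] inside [A] were not all of [A], it would be traversed by [rho]
   in both directions, and rounding half of [1_A] plus the signed indicator of
   [A'] would give a smaller 0/1-valued tension inside [A]. *)
Lemma minimal_tension_bond rho A :
    minset (fun A => `[< is_tension rho (fun e => (e \in A)%:Z) >] && (A != set0)) A ->
  directed_bond rho A.
Proof.
case/minsetP => /andP [/asboolP tA A0] minA.
have min A' : is_tension rho (fun e => (e \in A')%:Z) -> A' != set0 -> A' \subset A ->
    A' = A.
  by move=> tA' nA' sA'; apply: minA => //; rewrite nA' andbT; apply/asboolP.
have [S [AS tS]] : exists S : {set vertex G}, A = edge_cut S /\
    forall e, e \in A -> tail rho e \in S.
  have [h hE] := tA; have /set0Pn [e0 e0A] := A0.
  (* A superlevel set of the potential. Drops are 0 or 1, so its cut lies in [A], is crossed only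
     outwards and contains [e0]; minimality makes it all of [A]. *)
  pose S := [set v | h (tail rho e0) <= h v].
  have cutE e : (e \in edge_cut S)%:Z = (tail rho e \in S)%:Z - (head rho e \in S)%:Z.
    rewrite (edge_cutE rho) !inE; move: (hE e); case: (e \in A) => /= E.
      by case: leP; case: leP => //=; lia.
    have -> : h (tail rho e) = h (head rho e) by lia.
    by rewrite eqxx subrr.
  have sub : edge_cut S \subset A.
    apply/subsetP => e; rewrite (edge_cutE rho) !inE; apply: contraR => eA.
    by move: (hE e); rewrite (negPf eA) => E; apply/eqP; congr (_ <= _); lia.
  exists S; rewrite -(min (edge_cut S)) //.
  - split=> // e eS; move: (cutE e); rewrite eS.
    by case: (tail rho e \in S); case: (head rho e \in S).
  - have -> : (fun e => (e \in edge_cut S)%:Z) =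
      (fun e => (tail rho e \in S)%:Z - (head rho e \in S)%:Z) by apply/funext.
    exact: cut_tension.
  - apply/set0Pn; exists e0; rewrite (edge_cutE rho) !inE lexx.
    by move: (hE e0); rewrite e0A => ?; case: leP => //; lia.
apply/andP; split; last first.
  apply/existsP; exists S; rewrite AS eqxx; apply/forall_inP => e; rewrite -AS; exact: tS.
apply/minsetP; split.
  by rewrite A0 andbT; apply/existsP; exists S; rewrite AS.
move=> A' /andP [/existsP [S' /eqP A'E] A'0] A'A.
pose t e : int := (tail rho e \in S')%:Z - (head rho e \in S')%:Z.
have tt : is_tension rho t := cut_tension rho S'.
have tP e : [/\ -1 <= t e <= 1, (e \in A') = (t e != 0) & t e != 0 -> e \in A].
  have sub : e \in A' -> e \in A by apply/subsetP.
  rewrite A'E (edge_cutE rho) in sub *; rewrite /t; move: sub.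
  by case: (_ \in S'); case: (_ \in S') => /= sub; split=> // _; apply: sub.
have [|y [ty y0 y2]] := tension_rounding (q := 2) isT (tensionD tA tt).
  by move=> e; case: (tP e) => + _ +; case: (e \in A) => //= B1 B2; lia.
pose Y := [set e | y e].
have YA : Y \subset A.
  apply/subsetP => e; rewrite inE; apply: contraLR => eA.
  by rewrite y0 // (negPf eA) add0r; apply/eqP; apply: contraNT eA; case: (tP e).
have tY : is_tension rho (fun e => (e \in Y)%:Z).
  by have -> : (fun e => (e \in Y)%:Z) = (fun e => (y e)%:Z)
    by apply/funext => e; rewrite inE.
have A'ext (s : int) : (forall e, t e = s * (e \in A')%:Z) ->
    is_tension rho (fun e => s * t e) -> s * s = 1 -> A' = A.
  move=> sE ts ss; apply: min => //.
  have -> // : (fun e => (e \in A')%:Z) = (fun e => s * t e).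
  by apply/funext => e; rewrite sE mulrA ss mul1r.
(* By minimality [Y] is empty or all of [A]. In the first case [t] never takes the value 1, in the
   second never -1, so up to sign [t] is the indicator of [A']. *)
case: (eqVneq Y set0) => [Y0|Yn].
- apply: (A'ext (-1)) => // [e|].
    case: (tP e) => B1 -> /=; case: eqP => [->//|tn] /= /(_ isT) eA.
    have : y e = false by move/setP/(_ e): Y0; rewrite !inE.
    have : t e = 1 -> y e = true by move=> t1; apply: y2; rewrite eA t1.
    by move=> H1 H2; rewrite H2 in H1; have : t e <> 1 by [move=> /H1]; lia.
  have -> : (fun e => -1 * t e) = (fun e => - t e) by apply/funext => e; rewrite mulN1r.
  exact: tensionN.
- have YE : Y = A by apply: min.
  apply: (A'ext 1) => // [e|].
    case: (tP e) => B1 -> /=; case: eqP => [->//|tn] /= /(_ isT) eA.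
    have : y e = true by move/setP/(_ e): YE; rewrite !inE eA.
    have : t e = -1 -> y e = false by move=> t1; apply: y0; rewrite eA t1.
    by move=> H1 H2; rewrite H2 in H1; have : t e <> -1 by [move=> /H1]; lia.
  have -> : (fun e => 1 * t e) = t by apply/funext => e; rewrite mul1r.
  exact: tt.
Qed.

(** The tensions of disjoint directed bonds add up to the indicator of their union. Conversely, a
    minimal nonempty 0/1 tension inside [B] is a directed bond, and removing it leaves a 0/1
    tension. *)
Lemma locally_directed_cutP rho B :
  reflect (is_tension rho (fun e => (e \in B)%:Z)) (locally_directed_cut rho B).
Proof.
apply: (iffP andP) => [[_ /existsP [D /andP [pD /forall_inP dD]]]|tB].
  have /fin_all_exists [h hE] : forall A : {set edge G}, exists h : vertex G -> int,
      A \in D -> forall e, (e \in A)%:Z = h (tail rho e) - h (head rho e).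
    move=> A; case: (boolP (A \in D)) => [/dD/directed_bond_tension [h hE]|_].
      by exists h.
    by exists (fun=> 0).
  exists (fun v => \sum_(A in D) h A v) => e; rewrite -sumrB.
  under [RHS]eq_bigr => A AD do rewrite -(hE A AD).
  have ind (A : {set edge G}) : (e \in A)%:Z = \sum_(e' in A) (e' == e)%:Z.
    rewrite big_mkcond (bigD1 e) //= eqxx big1 ?addr0; first by case: (e \in A).
    by move=> e' /negPf ->; case: ifP.
  by rewrite ind (set_partition_big _ pD); apply: eq_bigr => A _; rewrite ind.
split.
  (* Drops are 0 or 1, so an edge lies in [B] exactly when the potential changes parity along it. *)
  have [h hE] := tB; apply/existsP; exists [set v | odd `|h v|%N].
  apply/eqP/setP => e; rewrite (edge_cutE rho) !inE.
  by move: (hE e); case: (e \in B) => /= E; lia.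
have [n] := ubnP #|B|; elim: n B tB => // n IH B tB; rewrite ltnS => leB.
case: (eqVneq B set0) => [->|Bn].
  apply/existsP; exists set0; rewrite partition_set0 eqxx /=.
  by apply/forall_inP => A; rewrite inE.
have [|A minA AB] := @minset_exists _
    (fun A => `[< is_tension rho (fun e => (e \in A)%:Z) >] && (A != set0)) B.
  by rewrite Bn andbT; apply/asboolP.
have /minsetP [/andP [/asboolP tA A0] _] := minA.
have [||D /andP [pD dD]] := existsP (IH (B :\: A) _ _).
- have -> : (fun e => (e \in B :\: A)%:Z) = (fun e => (e \in B)%:Z - (e \in A)%:Z).
    apply/funext => e; rewrite inE; have := subsetP AB e.
    by case: (e \in A) => [/(_ isT) ->|_]; case: (e \in B).
  exact: tensionB.
- apply: leq_trans leB; apply: proper_card; apply/properP; split; first exact: subsetDl.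
  by have /set0Pn [e eA] := A0; exists e; rewrite ?inE ?eA // (subsetP AB).
apply/existsP; exists (A |: D); apply/andP; split; last first.
  apply/forall_inP => A'; rewrite !inE => /orP [/eqP ->|].
    exact: minimal_tension_bond.
  by move: A'; apply/forall_inP.
have -> : B = A :|: (B :\: A) by rewrite -{1}(setID B A) (setIidPr AB).
by apply: partitionU1 => //; rewrite -setI_eq0 setIDA setDIl setDv set0I.
Qed.

Definition sgn rho e : int := if rho e then -1 else 1.

Definition ref_orientation : orientation G := [ffun=> false].

Definition reversal rho sigma e : int := if rho e == sigma e then 0 else sgn rho e.

Lemma drop_sgn rho (R : pzRingType) (h : vertex G -> R) e :
  drop_along rho h e = (sgn rho e)%:~R * drop_along ref_orientation h e.
Proof.
rewrite /drop_along /sgn /tail /head !ffunE.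
by case: (rho e); rewrite ?mul1r // mulN1r opprB.
Qed.

Lemma sgnK rho e (a : int) : sgn rho e * (sgn rho e * a) = a.
Proof. by rewrite /sgn; case: (rho e); rewrite ?mul1r // !mulN1r opprK. Qed.

Lemma tension_sgn rho f :
  is_tension rho f <-> is_tension ref_orientation (fun e => sgn rho e * f e).
Proof.
split=> -[h hE]; exists h => e.
  rewrite hE -[h (tail rho e) - _]/(drop_along rho h e) drop_sgn intz sgnK //.
by rewrite -[RHS]/(drop_along rho h e) drop_sgn intz -[drop_along _ _ _]hE sgnK.
Qed.

Lemma flow_sgn rho g :
  is_flow rho g <-> is_flow ref_orientation (fun e => sgn rho e * g e).
Proof.
have E h : \sum_e sgn rho e * g e * drop_along ref_orientation h e =
           \sum_e g e * drop_along rho h e.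
  by apply: eq_bigr => e _; rewrite (drop_sgn rho) intz; ring.
by split=> /is_flowP ci; apply/is_flowP => h; rewrite -[RHS](ci h) E.
Qed.

(** With r the reversal, in {-1, 0, 1}, the product of [b] and [- a] is b (b - r), nonnegative for
    integers; orthogonality makes it 0 at every edge. *)
Lemma reversal_split rho sigma a b :
    is_tension ref_orientation b -> is_flow ref_orientation a ->
    (forall e, b e + a e = reversal rho sigma e) ->
  forall e, (b e = 0 /\ a e = reversal rho sigma e) \/
            (a e = 0 /\ b e = reversal rho sigma e).
Proof.
move=> tb fa sE e.
have : b e * - a e = 0.
  apply: (tension_flow_eq0 tb (flowN fa)) => e'.
  have -> : - a e' = b e' - reversal rho sigma e' by rewrite -sE; ring.
  by rewrite /reversal /sgn; case: eqP => _; [|case: (rho e')]; nia.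
by have := sE e; move=> H /eqP; rewrite mulf_eq0 => /orP [] /eqP; lia.
Qed.

(** The locally directed cut and the Eulerian subgraph are the supports of [b] and [a], so
    equivalence becomes membership of the reversal in a lattice. *)
Lemma cut_eulerian_equivP rho sigma : reflect
  (exists b a, [/\ is_tension ref_orientation b, is_flow ref_orientation a
                 & forall e, b e + a e = reversal rho sigma e])
  (cut_eulerian_equiv rho sigma).
Proof.
apply: (iffP existsP) => [[B /existsP [A /and4P [/eqP I /eqP U]]]|[b [a [tb fa sE]]]].
  move=> /locally_directed_cutP /tension_sgn tB /directed_eulerianP /flow_sgn fA.
  eexists; eexists; split; [exact: tB | exact: fA | move=> e /=].
  move/setP/(_ e): I; move/setP/(_ e): U; rewrite !inE /reversal.
  by case: (e \in B); case: (e \in A); case: (rho e == sigma e) => //;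
    rewrite ?mulr1 ?mulr0 ?addr0 ?add0r.
have sp := reversal_split tb fa sE.
exists [set e | b e != 0]; apply/existsP; exists [set e | a e != 0].
apply/and4P; split.
- apply/eqP/setP => e; rewrite !inE.
  by case: (sp e) => -[-> _]; rewrite eqxx ?andbF.
- apply/eqP/setP => e; rewrite !inE; have := sp e; rewrite /reversal /sgn.
  by case: eqP; case: (rho e); lia.
- apply/locally_directed_cutP/tension_sgn.
  have <- // : b = (fun e => sgn rho e * (e \in [set e | b e != 0])%:Z).
  apply/funext => e; rewrite inE; have := sp e; rewrite /reversal /sgn.
  by case: eqP; case: (rho e); lia.
- apply/directed_eulerianP/flow_sgn.
  have <- // : a = (fun e => sgn rho e * (e \in [set e | a e != 0])%:Z).
  apply/funext => e; rewrite inE; have := sp e; rewrite /reversal /sgn.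
  by case: eqP; case: (rho e); lia.
Qed.

Lemma reversalE rho sigma e : reversal rho sigma e * 2 = sgn rho e - sgn sigma e.
Proof. by rewrite /reversal /sgn; case: (rho e); case: (sigma e). Qed.

(** Reversals add up along [rho], [sigma], [tau], and the sums of a tension and a flow form a
    group. *)
Lemma cut_eulerian_equivalence : equivalence_rel (@cut_eulerian_equiv G).
Proof.
apply/equivalence_relP; split=> [rho|rho sigma /cut_eulerian_equivP [b [a [tb fa sE]]] tau].
  apply/cut_eulerian_equivP; exists (fun=> 0), (fun=> 0).
  by split=> [||e]; [exact: tension0 | exact: flow0 | rewrite /reversal eqxx].
apply/cut_eulerian_equivP/cut_eulerian_equivP => -[b' [a' [tb' fa' sE']]].
  exists (fun e => b' e - b e), (fun e => a' e - a e).
  split=> [||e]; [exact: tensionB | exact: flowB |].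
  by move: (reversalE rho sigma e) (reversalE sigma tau e) (reversalE rho tau e)
    (sE e) (sE' e); lia.
exists (fun e => b e + b' e), (fun e => a e + a' e).
split=> [||e]; [exact: tensionD | exact: flowD |].
by move: (reversalE rho sigma e) (reversalE sigma tau e) (reversalE rho tau e)
  (sE e) (sE' e); lia.
Qed.

End CutEulerian.

(** * Tensions and flows with values in a finite ring *)

Section RingValued.
Variables (G : multigraph) (rho : orientation G) (R : finNzRingType).
Implicit Types (X Y : {set edge G}) (e : edge G).

Definition ring_potentials X : {set {ffun vertex G -> R}} :=
  [set h : {ffun vertex G -> R} | [forall e in X, drop_along rho h e == 0]].

Definition ring_tension (x : {ffun edge G -> R}) : bool :=
  [exists h : {ffun vertex G -> R}, [forall e, x e == drop_along rho h e]].

Definition ring_flow (w : {ffun edge G -> R}) : bool :=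
  [forall h : {ffun vertex G -> R}, \sum_e w e * drop_along rho h e == 0].

Definition ring_tensions X : {set {ffun edge G -> R}} :=
  [set x : {ffun edge G -> R} | ring_tension x & [forall e in X, x e == 0]].

Definition ring_flows X : {set {ffun edge G -> R}} :=
  [set w : {ffun edge G -> R} | ring_flow w & [forall e in ~: X, w e == 0]].

Lemma ring_flowP (w : {ffun edge G -> R}) : reflect (circulation rho w) (ring_flow w).
Proof.
apply: (iffP forallP) => H h; last exact/eqP/H.
rewrite -[RHS](eqP (H [ffun v => h v])); apply: eq_bigr => e _.
by rewrite /drop_along !ffunE.
Qed.

Lemma card_ring_potentials X : #|ring_potentials X| = (#|R| ^ components X)%N.
Proof.
have csym := @connect_adjacent_sym G X.
pose f (h : {ffun vertex G -> R}) : {ffun vertex G -> R} :=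
  [ffun v => h (fingraph.root (adjacent X) v)].
pose g (h : {ffun vertex G -> R}) : {ffun vertex G -> R} :=
  [ffun v => if v \in roots (adjacent X) then h v else 0].
have -> : components X = #|roots (adjacent X)|.
  by apply: eq_card => v; rewrite !inE andbT.
rewrite -(@card_pffun_on _ _ 0 _ predT) -[RHS]cardsE; apply/esym.
apply: (@card_bij _ _ _ _ f g).
- move=> h _; rewrite inE; apply/forall_inP => e eX.
  rewrite /drop_along !ffunE.
  have /(fingraph.rootP csym) -> : connect (adjacent X) (tail rho e) (head rho e).
    by apply/connect1/(adjacentP rho); exists e; auto.
  by rewrite subrr.
- move=> h _; rewrite inE; apply/pffun_onP; split=> //.
  by apply/supportP => v /negPf vr; rewrite ffunE vr.
- move=> h; rewrite inE => /pffun_onP [/supportP hs _]; apply/ffunP => v.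
  rewrite ffunE; case: ifPn => vr; last by rewrite hs.
  by rewrite ffunE; move: vr => /eqP ->.
- move=> h; rewrite inE => /forall_inP hX; apply/ffunP => v.
  have rr : fingraph.root (adjacent X) v \in roots (adjacent X) by exact: roots_root.
  rewrite ffunE ffunE rr.
  apply/esym/(connect_drop (rho := rho) (X := X)); last exact: connect_root.
  by move=> e /hX /eqP.
Qed.

(** The drop map is additive, so its fibres are cosets of the potentials without drops. *)
Lemma card_ring_tensions X :
  (#|ring_tensions X| * #|ring_potentials [set: edge G]| = #|ring_potentials X|)%N.
Proof.
pose d (h : {ffun vertex G -> R}) : {ffun edge G -> R} := [ffun e => drop_along rho h e].
have dD h k : d (h + k) = d h + d k.
  by apply/ffunP => e; rewrite !ffunE /drop_along !ffunE opprD addrACA.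
have d0 k : (k \in ring_potentials [set: edge G]) = (d k == 0).
  rewrite inE; apply/forall_inP/eqP => [H|H e _].
    by apply/ffunP => e; rewrite !ffunE; apply/eqP/H.
  by move/ffunP/(_ e): H; rewrite !ffunE => ->.
rewrite -[RHS]sum1_card (partition_big d (mem (ring_tensions X))) /=; last first.
  move=> h; rewrite !inE => /forall_inP hX; apply/andP; split.
    by apply/existsP; exists h; apply/forallP => e; rewrite ffunE.
  by apply/forall_inP => e /hX; rewrite ffunE.
rewrite -sum_nat_const; apply: eq_bigr => x; rewrite inE.
case/andP => /existsP [h0 /forallP xE] /forall_inP xX.
have dh0 : d h0 = x by apply/ffunP => e; rewrite ffunE (eqP (xE e)).
rewrite sum1dep_card; apply: (@card_bij _ _ _ _ (fun k => h0 + k) (fun h => h - h0)).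
- move=> k; rewrite d0 inE => /eqP dk; rewrite dD dk addr0 dh0 eqxx andbT inE.
  apply/forall_inP => e /xX xe; have /ffunP /(_ e) := dD h0 k.
  by rewrite dk addr0 dh0 ffunE => ->.
- move=> h; rewrite inE d0 => /andP [_ /eqP dh].
  have := dD (h - h0) h0; rewrite subrK dh dh0 => E.
  by rewrite -(inj_eq (addIr x)) -E add0r.
- by move=> k _; rewrite addrC addKr.
- by move=> h _; rewrite addrC subrK.
Qed.

(** Tested against the indicator of the component of [tail rho e], a flow leaves only its value at
    [e], which must vanish. *)
Lemma ring_flows_bridge Y e : ~~ connect (adjacent Y) (tail rho e) (head rho e) ->
  ring_flows (e |: Y) = ring_flows Y.
Proof.
move=> nc; apply/setP => w; rewrite !inE; apply: andb_id2l => /ring_flowP fw.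
apply/forall_inP/forall_inP => wX e'; rewrite !inE => e'Y; last first.
  by apply: wX; rewrite !inE; case/norP: e'Y.
case: (eqVneq e' e) => [->|ne]; last by apply: wX; rewrite !inE negb_or ne.
have := fw (fun v => (connect (adjacent Y) (tail rho e) v)%:R).
rewrite (bigD1 e) //= {1}/drop_along connect0 (negPf nc) subr0 mulr1.
rewrite big1 ?addr0 => [/eqP //|e2 ne].
case: (boolP (e2 \in Y)) => e2Y; first by rewrite comp_drop // mulr0.
by rewrite (eqP (wX _ _)) ?mul0r //; rewrite !inE negb_or ne e2Y.
Qed.

Lemma ring_potentials_cycle Y e : connect (adjacent Y) (tail rho e) (head rho e) ->
  ring_potentials (e |: Y) = ring_potentials Y.
Proof.
move=> c; apply/setP => h; rewrite !inE; apply/forall_inP/forall_inP => H e' e'Y.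
  by apply: H; rewrite !inE e'Y orbT.
move: e'Y; rewrite !inE => /orP [/eqP ->|/H //].
rewrite subr_eq0; apply/eqP; apply: (connect_drop (rho := rho)) c.
by move=> e2 /H /eqP.
Qed.

(** A walk in [Y] closes [e] to a circulation [c] with value 1 at [e]; every flow is a multiple of
    [c] plus a flow on [Y]. *)
Lemma card_ring_flows_cycle Y e : e \notin Y ->
    connect (adjacent Y) (tail rho e) (head rho e) ->
  #|ring_flows (e |: Y)| = (#|R| * #|ring_flows Y|)%N.
Proof.
move=> eY /(walk_flow rho) [z z0 zE].
pose c e' : R := (e' == e)%:R - (z e')%:~R.
have ce : c e = 1 by rewrite /c eqxx z0 ?inE // subr0.
have cY e' : e' \notin e |: Y -> c e' = 0.
  by rewrite !inE negb_or => /andP [/negPf ne e'Y]; rewrite /c ne z0 ?inE // subr0.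
have cci : circulation rho c.
  move=> h; under eq_bigr do rewrite mulrBl.
  rewrite sumrB zE (bigD1 e) //= eqxx mul1r big1 ?addr0 ?subrr //.
  by move=> e' /negPf ->; rewrite mul0r.
have mulc (a : R) h : \sum_e' a * c e' * drop_along rho h e' = 0.
  by under eq_bigr do rewrite -mulrA; rewrite -mulr_sumr cci mulr0.
rewrite -cardsT -cardsX.
apply/esym/(@card_bij _ _ _ _
  (fun aw : R * {ffun edge G -> R} => [ffun e' => aw.2 e' + aw.1 * c e'])
  (fun w : {ffun edge G -> R} => (w e, [ffun e' => w e' - w e * c e']))).
- move=> [a w]; rewrite !inE /= => /andP [/ring_flowP fw /forall_inP wY].
  apply/andP; split.
    apply/ring_flowP => h; under eq_bigr do rewrite ffunE mulrDl.
    by rewrite big_split /= fw mulc addr0.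
  apply/forall_inP => e' e'Y; rewrite ffunE cY; last by rewrite inE in e'Y.
  by rewrite mulr0 addr0 wY //; move: e'Y; rewrite !inE negb_or => /andP [].
- move=> w; rewrite !inE /= => /andP [/ring_flowP fw /forall_inP wY].
  apply/andP; split.
    apply/ring_flowP => h; under eq_bigr do rewrite ffunE mulrBl.
    by rewrite sumrB fw mulc subr0.
  apply/forall_inP => e' e'Y; rewrite ffunE.
  case: (eqVneq e' e) => [->|ne]; first by rewrite ce mulr1 subrr.
  have e'X : e' \notin e |: Y by rewrite inE in e'Y; rewrite !inE negb_or ne.
  by rewrite cY // mulr0 subr0 wY // inE.
- move=> [a w]; rewrite !inE /= => /andP [_ /forall_inP wY].
  have we : w e = 0 by apply/eqP/wY; rewrite inE.
  congr (_, _); first by rewrite ffunE we ce add0r mulr1.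
  by apply/ffunP => e'; rewrite !ffunE we ce add0r mulr1 addrK.
- by move=> w _; apply/ffunP => e'; rewrite !ffunE /= subrK.
Qed.

(** Dual to the cycle case: the indicator of a component has drop 1 at [e] and 0 on [Y]. *)
Lemma card_ring_potentials_bridge Y e :
    ~~ connect (adjacent Y) (tail rho e) (head rho e) ->
  #|ring_potentials Y| = (#|R| * #|ring_potentials (e |: Y)|)%N.
Proof.
move=> nc; pose c v : R := (connect (adjacent Y) (tail rho e) v)%:R.
have ce : drop_along rho c e = 1.
  by rewrite /drop_along /c connect0 (negPf nc) subr0.
have cY : {in Y, forall e', drop_along rho c e' = 0} by move=> e' ?; apply: comp_drop.
have dropD (h : {ffun vertex G -> R}) a e' :
    drop_along rho [ffun v => h v + a * c v] e' = drop_along rho h e' + a * drop_along rho c e'.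
  by rewrite /drop_along !ffunE mulrBr opprD addrACA.
rewrite -cardsT -cardsX.
apply/esym/(@card_bij _ _ _ _
  (fun ah : R * {ffun vertex G -> R} => [ffun v => ah.2 v + ah.1 * c v])
  (fun h : {ffun vertex G -> R} => (drop_along rho h e,
     [ffun v => h v + - drop_along rho h e * c v]))).
- move=> [a h]; rewrite !inE /= => /forall_inP hX; apply/forall_inP => e' e'Y.
  by rewrite dropD cY // mulr0 addr0 hX // !inE e'Y orbT.
- move=> h; rewrite !inE /= => /forall_inP hY; apply/forall_inP => e'.
  rewrite dropD !inE => /orP [/eqP ->|e'Y]; first by rewrite ce mulr1 subrr.
  by rewrite cY // mulr0 addr0 hY.
- move=> [a h]; rewrite !inE /= => /forall_inP hX.
  have he : drop_along rho h e = 0 by apply/eqP/hX; rewrite !inE eqxx.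
  rewrite dropD ce he add0r mulr1; congr (_, _); apply/ffunP => v.
  by rewrite !ffunE mulNr addrK.
- by move=> h _; apply/ffunP => v; rewrite !ffunE /= mulNr subrK.
Qed.

(** Edges are added one at a time: a bridge keeps the flows and divides the number of potentials by
    |R|, any other edge multiplies the number of flows by |R| and keeps the potentials. No dimension
    argument is involved, so the ring need not be a field. *)
Lemma card_ring_flows X :
  (#|ring_flows X| * #|R| ^ #|vertex G| = #|R| ^ #|X| * #|ring_potentials X|)%N.
Proof.
have [n] := ubnP #|X|; elim: n X => // n IH X; rewrite ltnS => leX.
case: (set_0Vmem X) => [->|[e eX]].
  have -> : ring_flows set0 = [set [ffun=> 0]].
    apply/setP => w; rewrite !inE; apply/andP/eqP => [[_ /forall_inP w0]|->].
      by apply/ffunP => e; rewrite ffunE; apply/eqP/w0; rewrite !inE.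
    split; last by apply/forall_inP => e _; rewrite ffunE.
    by apply/ring_flowP => h; rewrite big1 // => e _; rewrite ffunE mul0r.
  have -> : ring_potentials set0 = [set: _].
    by apply/setP => h; rewrite !inE; apply/forall_inP => e; rewrite inE.
  by rewrite cards1 cards0 cardsT card_ffun.
pose Y := X :\ e; have eY : e \notin Y by rewrite !inE eqxx.
have XE : X = e |: Y by rewrite setD1K.
have cX : #|X| = #|Y|.+1 by rewrite XE cardsU1 eY.
have lY : (#|Y| < n)%N by rewrite -cX.
have IHY := IH Y lY.
rewrite cX expnS -mulnA; case: (boolP (connect (adjacent Y) (tail rho e) (head rho e))) => c.
  by rewrite XE card_ring_flows_cycle // ring_potentials_cycle // -mulnA IHY.
by rewrite XE ring_flows_bridge // IHY (card_ring_potentials_bridge c) mulnCA.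
Qed.

End RingValued.

(** * Rank inequalities and exponents read off from the counts over finite rings *)

Section Ranks.
Variable G : multigraph.
Implicit Types X : {set edge G}.

Lemma components_le X : (components X <= #|vertex G|)%N.
Proof. exact: max_card. Qed.

Lemma components_anti X : (components [set: edge G] <= components X)%N.
Proof.
rewrite -(@leq_exp2l #|('F_2 : finNzRingType)|); last by rewrite card_Fp.
rewrite -!(card_ring_potentials (ref_orientation G) 'F_2); apply: subset_leq_card.
apply/subsetP => h; rewrite !inE => /forall_inP H; apply/forall_inP => e _.
exact: H.
Qed.

(** The number of flows over the field with two elements is positive, so its exponent |X| + c(X) -
    |V| is nonnegative. *)
Lemma card_vertex_le X : (#|vertex G| <= #|X| + components X)%N.
Proof.
have R1 : (1 < #|('F_2 : finNzRingType)|)%N by exact: card_finNzRing_gt1.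
have := card_ring_flows (ref_orientation G) 'F_2 X.
rewrite card_ring_potentials -expnD => E.
rewrite -(leq_exp2l _ _ R1) -E leq_pmull //.
have : (0 < #|('F_2 : finNzRingType)| ^ (#|X| + components X))%N.
  by rewrite expn_gt0 (ltnW R1).
by rewrite -E muln_gt0 => /andP [].
Qed.

Lemma rank_le_card X : (rank X <= #|X|)%N.
Proof. by rewrite leq_subLR addnC card_vertex_le. Qed.

Lemma rank_le X : (rank X <= rank [set: edge G])%N.
Proof. exact/leq_sub2l/components_anti. Qed.

Variable R : finNzRingType.

Lemma card_ring_tensions_rank X :
  #|ring_tensions (ref_orientation G) R X| =
  (#|R| ^ (rank [set: edge G] - rank X))%N.
Proof.
have R1 : (1 < #|R|)%N by exact: card_finNzRing_gt1.
apply/eqP; rewrite -(eqn_pmul2r (m := #|R| ^ components [set: edge G])) ?expn_gt0 ?(ltnW R1) //.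
rewrite -[X in (_ * X)%N == _](card_ring_potentials (ref_orientation G)).
rewrite card_ring_tensions card_ring_potentials -expnD eqn_exp2l //.
by rewrite /rank; have := (components_le X); have := (components_anti X); lia.
Qed.

Lemma card_ring_flows_nullity X :
  #|ring_flows (ref_orientation G) R X| = (#|R| ^ nullity X)%N.
Proof.
have R1 : (1 < #|R|)%N by exact: card_finNzRing_gt1.
apply/eqP; rewrite -(eqn_pmul2r (m := #|R| ^ #|vertex G|)) ?expn_gt0 ?(ltnW R1) //.
rewrite card_ring_flows card_ring_potentials -!expnD eqn_exp2l // /nullity /rank.
by have := components_le X; have := card_vertex_le X; lia.
Qed.

End Ranks.

(** * Encoding pairs by modular tensions and flows *)

Lemma Zp_int_eq0 p (k : int) : (k%:~R == 0 :> 'I_p.+2) = (p.+2%:Z %| k)%Z.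
Proof.
have nat_case (n : nat) : (n%:R == 0 :> 'I_p.+2) = (p.+2 %| n)%N.
  by rewrite Zp_nat -val_eqE.
case: (intP k) => [|n|n]; rewrite ?mulr0z ?eqxx ?dvdz0 // ?mulrNz ?oppr_eq0 -pmulrn nat_case //.
Qed.

Section Lifts.
Variables (G : multigraph) (p : nat).
Implicit Type x : {ffun edge G -> 'I_p.+2}.
Local Notation ref := (ref_orientation G).

(** The strict bound makes a lift vanish exactly where [x] does. *)
Definition is_lift x (t : edge G -> int) : Prop :=
  forall e, (t e)%:~R = x e /\ `|t e| < p.+2%:Z.

Lemma is_lift_eq0 x t e : is_lift x t -> (x e == 0) = (t e == 0).
Proof.
move=> /(_ e) [<- bnd]; rewrite Zp_int_eq0; apply/dvdzP/eqP => [[k kE]|->].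
  by move: bnd; rewrite kE; case: (eqVneq k 0) => [->|]; nia.
by exists 0; rewrite mul0r.
Qed.

Lemma is_lift_cong x t (k : int) e : is_lift x t -> k%:~R = x e ->
  exists b, k = t e + p.+2%:Z * b.
Proof.
move=> /(_ e) [<- _] /eqP; rewrite -subr_eq0 -rmorphB /= Zp_int_eq0 => /dvdzP [b bE].
by exists b; rewrite mulrC -bE addrC subrK.
Qed.

Lemma tension_lift x : ring_tension (ref_orientation G) x ->
  exists2 t, is_tension (ref_orientation G) t & is_lift x t.
Proof.
case/existsP => h /forallP xE.
exists (drop_along (ref_orientation G) (fun v => (h v : nat)%:Z)).
  by exists (fun v => (h v : nat)%:Z).
move=> e; rewrite (eqP (xE e)) /drop_along rmorphB /= -!pmulrn !natr_Zp; split=> //.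
move: (ltn_ord (h (tail ref e))) (ltn_ord (h (head ref e))).
by move: (nat_of_ord _) (nat_of_ord _) => i j; lia.
Qed.

(** Representatives are balanced only modulo p+2, and rounding corrects them by multiples of p+2.
    Nothing is subtracted where the representative is 0, so the bound stays strict. *)
Lemma flow_lift x : ring_flow (ref_orientation G) x ->
  exists2 t, is_flow (ref_orientation G) t & is_lift x t.
Proof.
move=> /ring_flowP xE.
have [//|e||y [yf y0 _]] :=
  @flow_rounding_mod G (ref_orientation G) p.+2 (fun e => (x e : nat)%:Z).
- by have := ltn_ord (x e); lia.
- move=> h; rewrite -Zp_int_eq0 rmorph_sum /= -[X in _ == X](xE (fun v => (h v)%:~R)).
  apply/eqP/eq_bigr => e _.
  by rewrite rmorphM /= -pmulrn natr_Zp /drop_along rmorphB.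
exists (fun e => (x e : nat)%:Z - p.+2%:Z * (y e)%:Z) => // e; split.
  rewrite rmorphB rmorphM /= -!pmulrn natr_Zp.
  have -> : p.+2%:R = 0 :> 'I_p.+2 by apply/eqP; rewrite pmulrn Zp_int_eq0.
  by rewrite mul0r subr0.
have := ltn_ord (x e); have := y0 e; case: (y e) => /=; last by lia.
by case: (eqVneq (x e : nat) 0%N) => [->/(_ erefl)//|]; lia.
Qed.

Lemma tension_mod t : is_tension (ref_orientation G) t ->
  ring_tension (ref_orientation G) [ffun e => (t e)%:~R : 'I_p.+2].
Proof.
case=> h hE; apply/existsP; exists [ffun v => (h v)%:~R]; apply/forallP => e.
by rewrite /drop_along !ffunE hE rmorphB.
Qed.

Lemma flow_mod t : is_flow (ref_orientation G) t ->
  ring_flow (ref_orientation G) [ffun e => (t e)%:~R : 'I_p.+2].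
Proof.
move=> /is_flowP ci; apply/forallP => h.
have := congr1 (fun z => z%:~R : 'I_p.+2) (ci (fun v => (h v : nat)%:Z)).
rewrite rmorph_sum /= => E; apply/eqP; rewrite -[RHS]E; apply: eq_bigr => e _.
by rewrite ffunE rmorphM /drop_along rmorphB /= -!pmulrn !natr_Zp.
Qed.

End Lifts.

Section Encoding.
Variables (G : multigraph) (p q : nat).
Local Notation m := p.+2.
Local Notation n := q.+2.
Local Notation ref := (ref_orientation G).
Variables (tl : {ffun edge G -> 'I_m} -> edge G -> int)
          (gl : {ffun edge G -> 'I_n} -> edge G -> int).
Hypothesis tlP : forall x, ring_tension ref x -> is_tension ref (tl x) /\ is_lift x (tl x).
Hypothesis glP : forall w, ring_flow ref w -> is_flow ref (gl w) /\ is_lift w (gl w).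
Implicit Types (rho : orientation G) (e : edge G).

(* A code is a triple [(x, w, X)] as in the header. *)
Definition code : Type :=
  ({ffun edge G -> 'I_m} * {ffun edge G -> 'I_n} * {set edge G})%type.

Definition codes : {set code} :=
  [set r : code | [&& ring_tension ref r.1.1, ring_flow ref r.1.2 &
     [forall e, if e \in r.2 then r.1.1 e == 0 else r.1.2 e == 0]]].

Definition code_orientation (r : code) : orientation G :=
  [ffun e => if r.1.1 e != 0 then tl r.1.1 e < 0 else
             if r.1.2 e != 0 then gl r.1.2 e < 0 else e \in r.2].

Definition pairs rho : {set {ffun edge G -> 'I_m.+1} * {ffun edge G -> 'I_n.+1}} :=
  [set fg : {ffun edge G -> 'I_m.+1} * {ffun edge G -> 'I_n.+1} |
   `[< [/\ is_tension rho (fun e => (fg.1 e)%:Z),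
              is_flow rho (fun e => (fg.2 e)%:Z)
            & forall e, (fg.1 e)%:Z * (fg.2 e)%:Z = 0] >]].

(** Where exactly one residue is nonzero, membership in the set is forced by [codes]. Where both
    vanish, a value equal to its full modulus differs from the lift 0 by one modulus, which counts
    as a reversal: there the bit of [rho] is flipped. *)
Definition encode rho (fg : {ffun edge G -> 'I_m.+1} * {ffun edge G -> 'I_n.+1}) : code :=
  let x := [ffun e => (sgn rho e * (fg.1 e)%:Z)%:~R] in
  let w := [ffun e => (sgn rho e * (fg.2 e)%:Z)%:~R] in
  (x, w, [set e | (x e == 0) && ((w e != 0) ||
                  (rho e (+) ((fg.1 e != 0 :> nat) || (fg.2 e != 0 :> nat))))]).

Lemma encodeP rho fg : fg \in pairs rho ->
  encode rho fg \in codes /\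
  exists b a, [/\ is_tension ref b, is_flow ref a,
    forall e, b e + a e = reversal rho (code_orientation (encode rho fg)) e,
    forall e, sgn rho e * (fg.1 e)%:Z = tl (encode rho fg).1.1 e + m%:Z * b e &
    forall e, sgn rho e * (fg.2 e)%:Z = gl (encode rho fg).1.2 e + n%:Z * a e].
Proof.
rewrite inE => /asboolP [/tension_sgn tf /flow_sgn fg' fg0].
case Er : (encode rho fg) => [[x w] X].
have xE : x = [ffun e => (sgn rho e * (fg.1 e)%:Z)%:~R] by case: Er.
have wE : w = [ffun e => (sgn rho e * (fg.2 e)%:Z)%:~R] by case: Er.
have XE : X = [set e | (x e == 0) && ((w e != 0) ||
                  (rho e (+) ((fg.1 e != 0 :> nat) || (fg.2 e != 0 :> nat))))].
  by rewrite xE wE; case: Er.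
have xt : ring_tension ref x by rewrite xE; apply: tension_mod tf.
have wf : ring_flow ref w by rewrite wE; apply: flow_mod fg'.
have [tt lt] := tlP xt; have [tg lg] := glP wf.
have /choice [b bE] : forall e, exists b, sgn rho e * (fg.1 e)%:Z = tl x e + m%:Z * b.
  by move=> e; apply: (is_lift_cong lt); rewrite xE ffunE.
have /choice [a aE] : forall e, exists a, sgn rho e * (fg.2 e)%:Z = gl w e + n%:Z * a.
  by move=> e; apply: (is_lift_cong lg); rewrite wE ffunE.
have tb : is_tension ref b.
  apply: (tension_cancel (q := m)) => //.
  have -> : (fun e => m%:Z * b e) = (fun e => sgn rho e * (fg.1 e)%:Z - tl x e).
    by apply/funext => e; rewrite bE addrC addKr.
  exact: tensionB.
have fa : is_flow ref a.
  apply: (flow_cancel (q := n)) => //.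
  have -> : (fun e => n%:Z * a e) = (fun e => sgn rho e * (fg.2 e)%:Z - gl w e).
    by apply/funext => e; rewrite aE addrC addKr.
  exact: flowB.
have small (k : nat) (F T B : int) :
    F = T + k.+2%:Z * B -> `|F| <= k.+2%:Z -> `|T| < k.+2%:Z ->
    B = -1 \/ B = 0 \/ B = 1.
  move=> E1 E2 E3; have [B1|[B1|B1]] : B < -1 \/ 1 < B \/ (-1 <= B <= 1) by lia.
  - by exfalso; nia.
  - by exfalso; nia.
  - by lia.
(* The bounds put both coefficients in {-1, 0, 1} and one of the two values is 0, so a finite case
   check at each edge remains. *)
have key e : ~~ ((x e != 0) && (w e != 0)) /\
    b e + a e = reversal rho (code_orientation (x, w, X)) e.
  rewrite /reversal /code_orientation ffunE XE inE /= (is_lift_eq0 e lt) (is_lift_eq0 e lg).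
  have [_] := lt e; have [_] := lg e; have := fg0 e; have := bE e; have := aE e.
  have := ltn_ord (fg.1 e); have := ltn_ord (fg.2 e).
  move: (nat_of_ord (fg.1 e)) (nat_of_ord (fg.2 e)) (tl x e) (gl w e) (b e) (a e).
  move=> F H T C B A; rewrite /sgn => H1 F1 AE BE FH C1 T1.
  have Bs : B = -1 \/ B = 0 \/ B = 1.
    by apply: (small p _ _ _ BE) => //; case: (rho e); lia.
  have As : A = -1 \/ A = 0 \/ A = 1.
    by apply: (small q _ _ _ AE) => //; case: (rho e); lia.
  have {}FH : F = 0%N \/ H = 0%N by lia.
  case: (rho e) AE BE; case: Bs => [|[|]] ->; case: As => [|[|]] -> AE BE;
    case: FH => ?; subst; case: (eqVneq T 0) => /= T0; case: (eqVneq C 0) => /= C0;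
    split=> //=; try lia; case: ifP => //; lia.
split; last by exists b, a; split=> // e; case: (key e).
rewrite inE xt wf /=; apply/forallP => e; case: (key e) => k _; rewrite XE inE.
by case: (x e == 0) k => /=; case: (w e == 0); rewrite //= ?eqxx; case: ifP.
Qed.

(** Equal codes have equal lifts and equal reversals, so b - b' = a' - a is both a tension and a
    flow, hence orthogonal to itself and 0. *)
Lemma encode_inj rho : {in pairs rho &, injective (@encode rho)}.
Proof.
move=> fg fg' /encodeP [_ [b [a [tb fa sE fE gE]]]].
move=> /encodeP [_ [b' [a' [tb' fa' sE' fE' gE']]]] Ec.
have bb e : b e = b' e /\ a e = a' e.
  have dd e' : a' e' - a e' = b e' - b' e'.
    move: (sE e') (sE' e'); rewrite Ec => E1 E2.
    by move: E1; rewrite -E2 => E1; lia.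
  have : (b e - b' e) * (a' e - a e) = 0.
    apply: (tension_flow_eq0 (tensionB tb tb') (flowB fa' fa)) => e'.
    by rewrite dd -expr2 sqr_ge0.
  move/eqP; rewrite dd mulf_eq0 orbb => /eqP E0.
  by have := dd e; lia.
case: fg fg' fE gE fE' gE' Ec {sE sE'} => [f g] [f' g'] /= fE gE fE' gE' Ec.
have inj e (i j : nat) : sgn rho e * i%:Z = sgn rho e * j%:Z -> i = j.
  by rewrite /sgn; case: (rho e); lia.
congr (_, _); apply/ffunP => e; apply/val_inj/(inj e) => /=.
  by rewrite fE fE' (bb e).1; case: Ec => ->.
by rewrite gE gE' (bb e).2; case: Ec => _ ->.
Qed.


(** The pair is rebuilt by adding to each lift its modulus times [b] or [a], and passing to the
    coordinates of [rho]. *)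
Lemma encode_surj rho (r : code) :
    r \in codes -> cut_eulerian_equiv rho (code_orientation r) ->
  exists2 fg, fg \in pairs rho & encode rho fg = r.
Proof.
case: r => [[x w] X]; rewrite inE /= => /and3P [xt wf /forallP xwX].
case/cut_eulerian_equivP => b [a [tb fa sE]].
have [tt lt] := tlP xt; have [tg lg] := glP wf.
have sp := reversal_split tb fa sE.
set sig := code_orientation (x, w, X) in sE sp.
have sgT e : 0 <= sgn sig e * tl x e.
  rewrite /sgn /sig ffunE /= (is_lift_eq0 e lt).
  by case: (eqVneq (tl x e) 0) => [->|]; rewrite ?mulr0 //=; case: ifP; lia.
have gl0 e : tl x e != 0 -> gl w e = 0.
  have := xwX e; rewrite (is_lift_eq0 e lt) (is_lift_eq0 e lg).
  by case: (e \in X) => [->|/eqP].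
have sgC e : 0 <= sgn sig e * gl w e.
  rewrite /sgn /sig ffunE /= (is_lift_eq0 e lt) (is_lift_eq0 e lg).
  case: (eqVneq (tl x e) 0) => [_ |/gl0 ->]; last by rewrite mulr0.
  by case: (eqVneq (gl w e) 0) => [->|]; rewrite ?mulr0 //=; case: ifP; lia.
(* A nonzero [a e] marks a reversed edge and has the sign opposite to [sig], whereas the lift has
   the sign of [sig]; so the products with [- a] are nonnegative. *)
have ta e : tl x e * a e = 0.
  have /eqP : tl x e * - a e = 0.
    apply: (tension_flow_eq0 tt (flowN fa)) => e'.
    move: (sp e') (sgT e'); rewrite /reversal /sgn.
    by case: (rho e'); case: (sig e') => /=; nia.
  by rewrite mulrN oppr_eq0 => /eqP.
have gb e : b e * gl w e = 0.
  have /eqP : - b e * gl w e = 0.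
    apply: (tension_flow_eq0 (tensionN tb) tg) => e'.
    move: (sp e') (sgC e'); rewrite /reversal /sgn.
    by case: (rho e'); case: (sig e') => /=; nia.
  by rewrite mulNr oppr_eq0 => /eqP.
(* Hence a nonzero lift is moved only by its own coefficient, across 0 to the side of [rho]; at a
   common zero one value may jump to its full modulus. *)
have range e : [/\ 0 <= sgn rho e * (tl x e + m%:Z * b e) <= m%:Z,
     0 <= sgn rho e * (gl w e + n%:Z * a e) <= n%:Z,
     (tl x e + m%:Z * b e = 0) \/ (gl w e + n%:Z * a e = 0) &
     (e \in X) = (tl x e == 0) && ((gl w e != 0) ||
       (rho e (+) ((tl x e + m%:Z * b e != 0) || (gl w e + n%:Z * a e != 0))))].
  have TA : tl x e = 0 \/ a e = 0.
    by move/eqP: (ta e); rewrite mulf_eq0 => /orP [] /eqP; auto.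
  have BC : b e = 0 \/ gl w e = 0.
    by move/eqP: (gb e); rewrite mulf_eq0 => /orP [] /eqP; auto.
  move: TA BC (xwX e) (sp e) (proj2 (lt e)) (proj2 (lg e)).
  rewrite (is_lift_eq0 e lt) (is_lift_eq0 e lg) /reversal /sgn.
  have -> : sig e = if tl x e != 0 then tl x e < 0 else
      if gl w e != 0 then gl w e < 0 else e \in X.
    by rewrite /sig ffunE /= (is_lift_eq0 e lt) (is_lift_eq0 e lg).
  move: (tl x e) (gl w e) (b e) (a e) (e \in X) (rho e) => T C B A inX r.
  case: (eqVneq T 0) => [->|T0] /=; case: (eqVneq C 0) => [->|C0] /= TA BC.
  - by case: inX; case: r => //= _ sp' _ _;
      case: sp' => -[-> ->]; split; rewrite ?mulr0 ?mulr1 ?addr0 //=; lia.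
  - case: inX => //= _ + _ C1; have -> : B = 0 by lia.
    by case: r; case: (ltP C 0) => CC /= [] [H1 H2]; rewrite ?H1 ?H2; split=> //=; lia.
  - case: inX => //= _ + T1 _; have -> : A = 0 by lia.
    by case: r; case: (ltP T 0) => TT /= [] [H1 H2]; rewrite ?H1 ?H2; split=> //=; lia.
  - by case: inX.
pose f : {ffun edge G -> 'I_m.+1} := [ffun e => inord `|tl x e + m%:Z * b e|].
pose g : {ffun edge G -> 'I_n.+1} := [ffun e => inord `|gl w e + n%:Z * a e|].
have sabs (k : nat) (z : int) e : 0 <= sgn rho e * z <= k%:Z ->
    (`|z| <= k)%N /\ (`|z|%N)%:Z = sgn rho e * z.
  by rewrite /sgn; case: (rho e); lia.
have fE e : (f e)%:Z = sgn rho e * (tl x e + m%:Z * b e).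
  by case: (range e) => /sabs [H1 <-] _ _ _; rewrite ffunE inordK.
have gE e : (g e)%:Z = sgn rho e * (gl w e + n%:Z * a e).
  by case: (range e) => _ /sabs [H1 <-] _ _; rewrite ffunE inordK.
have sfE e : sgn rho e * (f e)%:Z = tl x e + m%:Z * b e by rewrite fE sgnK.
have sgE e : sgn rho e * (g e)%:Z = gl w e + n%:Z * a e by rewrite gE sgnK.
have f0 e : (f e != 0 :> nat) = (tl x e + m%:Z * b e != 0).
  by rewrite -sfE /sgn; case: (rho e); lia.
have g0 e : (g e != 0 :> nat) = (gl w e + n%:Z * a e != 0).
  by rewrite -sgE /sgn; case: (rho e); lia.
have modE k (z c : int) : (z + k.+2%:Z * c)%:~R = z%:~R :> 'I_k.+2.
  by apply/eqP; rewrite -subr_eq0 -rmorphB /= addrAC subrr add0r Zp_int_eq0 dvdz_mulr.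
exists (f, g); last first.
  rewrite /encode /=.
  have -> : [ffun e => (sgn rho e * (f e)%:Z)%:~R] = x.
    by apply/ffunP => e; rewrite ffunE sfE modE; case: (lt e).
  have -> : [ffun e => (sgn rho e * (g e)%:Z)%:~R] = w.
    by apply/ffunP => e; rewrite ffunE sgE modE; case: (lg e).
  congr (_, _); apply/setP => e; rewrite inE f0 g0 (is_lift_eq0 e lt) (is_lift_eq0 e lg).
  by case: (range e).
rewrite inE; apply/asboolP; split=> [||e].
- apply/tension_sgn; have -> : (fun e => sgn rho e * (f e)%:Z) =
    (fun e => tl x e - - (m%:Z * b e)) by apply/funext => e; rewrite sfE opprK.
  case: tb => h hE; apply: tensionB => //; exists (fun v => - (m%:Z * h v)) => e.
  by rewrite hE; ring.
- apply/flow_sgn; have -> : (fun e => sgn rho e * (g e)%:Z) =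
    (fun e => gl w e + n%:Z * a e) by apply/funext => e; rewrite sgE.
  apply: flowD => //; apply/is_flowP => h; move/is_flowP: fa => fa.
  by under eq_bigr do rewrite -mulrA; rewrite -mulr_sumr fa mulr0.
- rewrite fE gE; case: (range e) => _ _ + _.
  by case=> ->; rewrite !mulr0 ?mul0r.
Qed.

Lemma sum_pairs rho (W : code -> rat) :
  \sum_(fg in pairs rho) W (encode rho fg) =
  \sum_(r in codes | cut_eulerian_equiv rho (code_orientation r)) W r.
Proof.
rewrite -(big_imset _ (@encode_inj rho)); apply: eq_bigl => r; apply/imsetP/andP.
  case=> fg fgP ->; have [cP [b [a [tb fa sE _ _]]]] := encodeP fgP.
  by split=> //; apply/cut_eulerian_equivP; exists b, a.
by case=> rc rE; have [fg fgP <-] := encode_surj rc rE; exists fg.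
Qed.

(** Codes are grouped by the class of their orientation. Weight 1 gives the first identity, the sign
    on crowded codes the second. *)
Lemma sum_classes (rep : {set orientation G} -> orientation G) (W : code -> rat) :
    (forall C, C \in ce_classes G -> rep C \in C) ->
  \sum_(C in ce_classes G) \sum_(fg in pairs (rep C)) W (encode (rep C) fg) =
  \sum_(r in codes) W r.
Proof.
move=> hrep.
have eqv := @cut_eulerian_equivalence G.
have part : partition (ce_classes G) [set: orientation G].
  by apply: equivalence_partitionP => x y z _ _ _; apply: eqv.
rewrite [RHS](partition_big (code_orientation) (mem [set: orientation G])) => [|r _];
  last exact: in_setT.
rewrite (set_partition_big _ part); apply: eq_bigr => C CP; rewrite sum_pairs.
have CE sigma : (sigma \in C) = cut_eulerian_equiv (rep C) sigma.
  have /imsetP [rho _ CE] := CP; have r1 := hrep C CP.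
  have inC tau : (tau \in C) = cut_eulerian_equiv rho tau by rewrite CE !inE.
  rewrite inC in r1; rewrite inC.
  by have [_ ->] := eqv rho (rep C) sigma.
rewrite (partition_big (code_orientation) (mem C)) => [|r /andP [_]]; last by rewrite -CE.
apply: eq_bigr => sigma; rewrite -[_ sigma]/(sigma \in C) CE => sC; apply: eq_bigl => r.
by rewrite -andbA; case: eqP => [->|_]; rewrite ?andbF ?sC ?andbT.
Qed.

End Encoding.

(** * Evaluations at integers *)

Section BivariateEvaluation.

Lemma poly_eq_nat (R : idomainType) (f : nat -> R) (P Q : {poly R}) : injective f ->
  (forall k, P.[f k] = Q.[f k]) -> P = Q.
Proof.
move=> inj E; apply/eqP; rewrite -subr_eq0; apply/negPn/negP => nz.
have := @max_poly_roots _ (P - Q) (map f (iota 0 (size (P - Q)))) nz.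
rewrite size_map size_iota ltnn map_inj_uniq // iota_uniq => /(_ _ isT) H.
suff : false by []; apply: H; apply/allP => _ /mapP [k _ ->].
by rewrite /root hornerD hornerN E subrr.
Qed.

(** Evaluation starts at 2, where the integers modulo p and modulo q are nonzero rings. *)
Lemma poly2_eq (P Q : {poly {poly rat}}) :
  (forall p q : nat, P.[p.+2%:R, q.+2%:R] = Q.[p.+2%:R, q.+2%:R]) -> P = Q.
Proof.
move=> E; apply: (@poly_eq_nat _ (fun p => (p.+2%:R : rat)%:P)) => [i j /polyC_inj|p].
  by move/eqP; rewrite eqr_nat => /eqP [].
apply: (@poly_eq_nat _ (fun q => q.+2%:R : rat)) => [i j|q]; last exact: E.
by move/eqP; rewrite eqr_nat => /eqP [].
Qed.

Lemma horner_negXY (P : {poly {poly rat}}) (x y : rat) :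
  (negXY P).[x, y] = P.[- x, - y].
Proof.
rewrite /negXY horner_comp hornerN hornerX -polyCN.
elim/poly_ind: P => [|P c IH]; first by rewrite rmorph0 !horner0.
rewrite rmorphD rmorphM /= map_polyX map_polyC /= !hornerMXaddC !hornerD !hornerM IH.
by rewrite !hornerC horner_comp hornerN hornerX.
Qed.

Lemma product_poly (P Q : {poly rat}) (x y : rat) :
  (map_poly polyC P * Q%:P).[x, y] = P.[x] * Q.[y].
Proof. by rewrite hornerM hornerC horner_map hornerM hornerC. Qed.

End BivariateEvaluation.

(** * Factorization and polynomiality of the two counting functions *)

Section Counting.
Variable G : multigraph.
Implicit Types (rho : orientation G) (e : edge G) (X : {set edge G}).

(** A nonnegative tension and a nonnegative flow have disjoint supports by orthogonality, so the
    count factors. *)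
Lemma kappa_bar_countE rho p q : kappa_bar_count rho p q =
  (#|face (is_tension rho) p [::] [::]| * #|face (is_flow rho) q [::] [::]|)%N.
Proof.
rewrite -cardsX; apply: eq_card => -[f g]; rewrite !inE /= !andbT.
apply/asboolP/andP => [[tf fg _]|[/asboolP tf /asboolP fg]].
  by split; apply/asboolP.
by split=> //; apply: (tension_flow_eq0 tf fg).
Qed.

Lemma kappa_barE rho (p q : nat) :
  (kappa_bar rho).[p%:R, q%:R] = (kappa_bar_count rho p q)%:R.
Proof.
have [P PE] := face_poly0 (tension0 rho) (@tensionD _ rho) (@tensionB _ rho)
  (@tension_rounding _ rho).
have [Q QE] := face_poly0 (flow0 rho) (@flowD _ rho) (@flowB _ rho)
  (@flow_rounding _ rho).
have ex : exists R : {poly {poly rat}}, forall p q : nat,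
    R.[p%:R, q%:R] = (kappa_bar_count rho p q)%:R.
  exists (map_poly polyC P * Q%:P) => i j.
  by rewrite product_poly PE // QE // kappa_bar_countE natrM.
exact: (xgetPex 0 ex).
Qed.

Definition zero_on (A : {set edge G}) : seq (edge G * bool) :=
  [seq (e, false) | e <- enum A].

Definition not_extremal_on (A : {set edge G}) : seq (edge G * bool) :=
  [seq (e, b) | e <- enum A, b <- [:: false; true]].

(** In a pair counted by [kappa_count], the flow is positive exactly on the edges of directed
    circuits and the tension exactly on the others. The supports being fixed, the count is again a
    product. *)
Definition open_pairs rho p q : {set {ffun edge G -> 'I_p.+1} * {ffun edge G -> 'I_q.+1}} :=
  let C := circuit_edges rho in
  setX (face (is_tension rho) p (zero_on C) (not_extremal_on (~: C)))
       (face (is_flow rho) q (zero_on (~: C)) (not_extremal_on C)).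

Lemma faceP (L : (edge G -> int) -> Prop) p (A : {set edge G})
    (x : {ffun edge G -> 'I_p.+1}) : reflect
  [/\ L (fun e => (x e)%:Z), {in A, forall e, x e = 0%N :> nat}
    & forall e, e \notin A -> (0 < x e < p)%N]
  (x \in face L p (zero_on A) (not_extremal_on (~: A))).
Proof.
rewrite inE; apply: (iffP and3P) => [[/asboolP Lx /allP x0 /allP xn]|[Lx x0 xn]].
  split=> // [e eA|e eA].
    by apply/eqP/(x0 (e, false)); apply: map_f; rewrite mem_enum.
  have H b : (e, b) \in not_extremal_on (~: A).
    by apply/allpairsP; exists (e, b); rewrite mem_enum !inE eA; case: b.
  have := xn _ (H true); have := xn _ (H false); rewrite /extremal /= mul1n mul0n.
  by have := ltn_ord (x e); lia.
split; first exact/asboolP.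
- by apply/allP => _ /mapP [e + ->]; rewrite mem_enum => /x0 E; apply/eqP.
- apply/allP => _ /allpairsP [[e b] [/= + _ ->]]; rewrite mem_enum inE => /xn.
  by rewrite /extremal /=; case: b; lia.
Qed.

Lemma open_pairsP rho p q (f : {ffun edge G -> 'I_p.+1}) (g : {ffun edge G -> 'I_q.+1}) :
  (0 < p)%N -> (0 < q)%N -> reflect
  [/\ is_tension rho (fun e => (f e)%:Z), is_flow rho (fun e => (g e)%:Z)
    & forall e, ((f e)%:Z * (g e)%:Z = 0 /\ 0 < (f e)%:Z + (g e)%:Z) /\
                (f e < p)%N /\ (g e < q)%N]
  ((f, g) \in open_pairs rho p q).
Proof.
move=> p0 q0; rewrite inE /= -{4}[circuit_edges rho]setCK.
apply: (iffP andP) => [[/faceP [tf f0 fn] /faceP [fg g0 gn]]|[tf fg H]].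
  split=> // e; case: (boolP (e \in circuit_edges rho)) => eC.
    by move: (f0 e eC) (gn e); rewrite in_setC negbK => -> /(_ eC); lia.
  by move: (g0 e) (fn e eC); rewrite in_setC => /(_ eC) ->; lia.
have f0 e : e \in circuit_edges rho -> f e = 0%N :> nat.
  by move=> /(circuit_tension_eq0 tf) => /(_ (fun _ => isT)) [].
have g0 e : e \notin circuit_edges rho -> g e = 0%N :> nat.
  move=> eC; apply/eqP; apply: contraNT eC => ge; apply: (positive_flow_circuit fg) => //.
  by rewrite ltz_nat lt0n.
split; apply/faceP; split=> // e; rewrite ?in_setC ?negbK.
- by move/g0; have := H e; lia.
- exact: g0.
- by move/f0; have := H e; lia.
Qed.

Lemma kappa_countE rho p q : (0 < p)%N -> (0 < q)%N ->
  kappa_count rho p q = #|open_pairs rho p q|.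
Proof.
move=> p0 q0.
pose u r (x : {ffun edge G -> 'I_r}) : {ffun edge G -> 'I_r.+1} :=
  [ffun e => widen_ord (leqnSn r) (x e)].
have uE r (x : {ffun edge G -> 'I_r}) e : u r x e = x e :> nat by rewrite ffunE.
pose d r (r0 : (0 < r)%N) (x : {ffun edge G -> 'I_r.+1}) : {ffun edge G -> 'I_r} :=
  [ffun e => insubd (Ordinal r0) (x e : nat)].
have dE r r0 (x : {ffun edge G -> 'I_r.+1}) e : (x e < r)%N -> d r r0 x e = x e :> nat.
  by move=> lt; rewrite ffunE val_insubd lt.
apply: (@card_bij _ _ _ _ (fun fg => (u p fg.1, u q fg.2))
          (fun fg => (d p p0 fg.1, d q q0 fg.2))).
- move=> [f g]; rewrite inE /= => /asboolP [tf fg H]; apply/open_pairsP => //.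
  have E r (x : {ffun edge G -> 'I_r}) : (fun e => (u r x e)%:Z) = (fun e => (x e)%:Z).
    by apply/funext => e; rewrite uE.
  by rewrite !E; split=> // e; rewrite !uE; split; [exact: H | rewrite !ltn_ord].
- move=> [f g] /open_pairsP [] // tf fg H; rewrite inE; apply/asboolP => /=.
  have fd e : d p p0 f e = f e :> nat by apply: dE; case: (H e) => _ [].
  have gd e : d q q0 g e = g e :> nat by apply: dE; case: (H e) => _ [].
  have -> : (fun e => (d p p0 f e)%:Z) = (fun e => (f e)%:Z) by apply/funext => e; rewrite fd.
  have -> : (fun e => (d q q0 g e)%:Z) = (fun e => (g e)%:Z) by apply/funext => e; rewrite gd.
  by split=> // e; rewrite fd gd; case: (H e).
- move=> [f g] _ /=; congr (_, _); apply/ffunP => e; apply/val_inj.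
    by rewrite /= dE uE ?ltn_ord.
  by rewrite /= dE uE ?ltn_ord.
- move=> [f g] /open_pairsP [] // tf fg H /=; congr (_, _); apply/ffunP => e; apply/val_inj.
    by rewrite /= uE dE //; case: (H e) => _ [].
  by rewrite /= uE dE //; case: (H e) => _ [].
Qed.

Lemma kappaE rho (p q : nat) : (0 < p)%N -> (0 < q)%N ->
  (kappa rho).[p%:R, q%:R] = (kappa_count rho p q)%:R.
Proof.
have [P PE] := face_poly1 (@tensionD _ rho) (@tensionB _ rho)
  (@tension_rounding _ rho) (zero_on (circuit_edges rho))
  (not_extremal_on (~: circuit_edges rho)).
have [Q QE] := face_poly1 (@flowD _ rho) (@flowB _ rho)
  (@flow_rounding _ rho) (zero_on (~: circuit_edges rho))
  (not_extremal_on (circuit_edges rho)).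
have ex : exists R : {poly {poly rat}}, forall p q : nat, (0 < p)%N -> (0 < q)%N ->
    R.[p%:R, q%:R] = (kappa_count rho p q)%:R.
  exists (map_poly polyC P * Q%:P) => i j i0 j0.
  by rewrite product_poly PE // QE // kappa_countE // cardsX natrM.
exact: (xgetPex 0 ex).
Qed.

Definition crowded p q (r : code G p q) : bool := [forall e, (r.1.1 e != 0) || (r.1.2 e != 0)].

Lemma sgn_mod_eq0 rho (p k : nat) e : (k <= p.+2)%N ->
  ((sgn rho e * k%:Z)%:~R == 0 :> 'I_p.+2) = (k == 0%N) || (k == p.+2).
Proof.
move=> lek; rewrite Zp_int_eq0.
have -> : (p.+2%:Z %| sgn rho e * k%:Z)%Z = (p.+2 %| k)%N.
  by rewrite /sgn; case: (rho e); rewrite ?mul1r // mulN1r dvdzE abszN.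
apply/idP/idP => [|/orP [] /eqP -> //].
case: (posnP k) => [->//|k0] /(dvdn_leq k0) le; apply/orP; right.
by rewrite eqn_leq lek.
Qed.

(** Residues vanish exactly at the extreme values. As one of the two values is 0, an edge fails to
    be a common zero exactly when the other value lies strictly inside its range. *)
Lemma open_pairs_crowded rho p q
    (f : {ffun edge G -> 'I_p.+3}) (g : {ffun edge G -> 'I_q.+3}) :
  ((f, g) \in open_pairs rho p.+2 q.+2) =
  ((f, g) \in pairs p q rho) && crowded (encode rho (f, g)).
Proof.
have le r (x : {ffun edge G -> 'I_r.+3}) e : (x e <= r.+2)%N by rewrite -ltnS.
apply/open_pairsP/andP => // [[tf fg H]|[]].
  split; first by rewrite inE; apply/asboolP; split=> // e; case: (H e) => [[]].
  apply/forallP => e; rewrite /= !ffunE !sgn_mod_eq0 //.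
  by have := H e; lia.
rewrite inE => /asboolP [tf fg H] /forallP cr; split=> // e.
have /eqP := H e; rewrite mulf_eq0; move: (cr e) (H e) (le _ f e) (le _ g e).
rewrite /= !ffunE !sgn_mod_eq0 //.
move: (nat_of_ord _) (nat_of_ord _) => i j ci -> lei lej zero.
by split; last split; first split=> //; lia.
Qed.

(** The set of the code consists of the edges where the tension vanishes, that is, where the flow is
    positive; so the sign of the code depends on [rho] only. *)
Lemma crowded_circuit_edges rho p q
    (fg : {ffun edge G -> 'I_p.+3} * {ffun edge G -> 'I_q.+3}) :
    fg \in open_pairs rho p.+2 q.+2 ->
  (encode rho fg : code G p q).2 = circuit_edges rho.
Proof.
case: fg => f g fgP; have := fgP; rewrite open_pairs_crowded => /andP [_ /forallP cr].
have le r (x : {ffun edge G -> 'I_r.+3}) e : (x e <= r.+2)%N by rewrite -ltnS.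
move: fgP => /open_pairsP [] // tf fg H; apply/setP => e.
have -> : (e \in (encode rho (f, g) : code G p q).2) = (f e == 0 :> nat).
  move: (cr e); rewrite inE /= !ffunE !sgn_mod_eq0 //.
  by have := H e; case: (rho e); lia.
apply/eqP/idP => [f0|eC]; last by case: (circuit_tension_eq0 tf (fun _ => isT) eC).
by apply: (positive_flow_circuit fg) => //; have := H e; lia.
Qed.

End Counting.

(** * Weighted sums over codes *)

Section Totals.
Variables (G : multigraph) (p q : nat).
Implicit Types (rho : orientation G) (e : edge G) (X : {set edge G}).

Lemma rank_gen_polyE (x y : rat) : (rank_gen_poly G).[x, y] =
  \sum_(X : {set edge G}) x ^+ (rank [set: edge G] - rank X) * y ^+ nullity X.
Proof.
rewrite /rank_gen_poly !horner_sum; apply: eq_bigr => X _.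
by rewrite hornerM -polyC_exp hornerC !hornerXn hornerM -polyC_exp hornerC hornerXn.
Qed.

(** For a fixed [X] the codes form a product: tensions vanishing on [X] and flows supported in
    [X]. *)
Lemma sum_codes (v : {set edge G} -> rat) :
  \sum_(r in codes G p q) v r.2 =
  \sum_X v X * (p.+2%:R ^+ (rank [set: edge G] - rank X) * q.+2%:R ^+ nullity X).
Proof.
rewrite (partition_big snd predT) //=; apply: eq_bigr => X _.
transitivity (\sum_(xw in setX (ring_tensions (ref_orientation G) 'I_p.+2 X)
    (ring_flows (ref_orientation G) 'I_q.+2 X)) v X); last first.
  rewrite sumr_const cardsX card_ring_tensions_rank card_ring_flows_nullity !card_ord.
  by rewrite -!natrX -natrM mulr_natr.
rewrite (reindex_onto (fun xw => (xw, X)) fst) => [|[xw Y] /= /andP [_ /eqP ->] //].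
apply: eq_big => [[x w]|xw /andP []] //=; rewrite !inE !eqxx !andbT /=.
apply/and3P/andP => [[xt wf /forallP H]|[/andP [xt /forall_inP xX] /andP [wf /forall_inP wX]]].
  rewrite xt wf; split; apply/forall_inP => e; have := H e.
    by case: (e \in X).
  by rewrite inE; case: (e \in X).
split=> //; apply/forallP => e; case: (boolP (e \in X)) => eX; first exact: xX.
by apply: wX; rewrite inE.
Qed.

(* On codes that are not crowded, toggling an edge on which both coordinates
   vanish is a sign-reversing involution. *)
Lemma sum_codes_sign :
  \sum_(r in codes G p q) (-1) ^+ #|r.2| =
  \sum_(r in codes G p q) (if crowded r then (-1) ^+ #|r.2| else 0) :> rat.
Proof.
rewrite (bigID (@crowded G p q)) [RHS](bigID (@crowded G p q)) /=; congr (_ + _).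
  by apply: eq_bigr => r /andP [_ ->].
rewrite [RHS]big1; last by move=> r /andP [_ /negPf ->].
(* The edge is chosen from [r.1] alone, which toggling preserves; this makes the toggle an
   involution. *)
pose z (xw : {ffun edge G -> 'I_p.+2} * {ffun edge G -> 'I_q.+2}) :=
  [pick e | ~~ ((xw.1 e != 0) || (xw.2 e != 0))].
pose flip e X := if e \in X then X :\ e else e |: X.
pose tog (r : code G p q) : code G p q :=
  if z r.1 is Some e then (r.1, flip e r.2) else r.
have flipE e X e' : (e' \in flip e X) = (e' \in X) (+) (e' == e).
  rewrite /flip; case: ifP => eX; rewrite !inE; case: eqP => [->|_];
    by rewrite ?eX ?addbF ?addbT.
have flipK e : involutive (flip e).
  by move=> X; apply/setP => e'; rewrite !flipE -addbA addbb addbF.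
have tog1 r : (tog r).1 = r.1 by rewrite /tog; case: (z r.1).
have togK : involutive tog.
  move=> [xw X]; rewrite /tog /=; case Ez: (z xw) => [e|] /=; rewrite Ez //=.
  by rewrite flipK.
set S := \sum_(i in _ | _) _; suff SN : S = - S by lra.
rewrite {1}/S (reindex_inj (inv_inj togK)) /= -sumrN; apply: eq_big => r.
  rewrite /crowded tog1; congr (_ && _); rewrite !inE tog1.
  congr [&& _, _ & _]; rewrite /tog /z; case: pickP => [e|//] /=.
  rewrite negb_or !negbK => /andP [/eqP x0 /eqP w0]; apply: eq_forallb => e'.
  rewrite flipE; case: eqP => [->|_]; last by rewrite addbF.
  by rewrite x0 w0 eqxx !if_same.
case/andP => _; rewrite /tog /z; case: pickP => [e _ _ /=|none]; last first.
  by case/negP; apply/forallP => e; have := none e; move/negbT; rewrite negbK.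
rewrite /flip; case: ifP => er.
  by rewrite [in RHS](cardsD1 e) er exprS mulN1r opprK.
by rewrite cardsU1 er exprS mulN1r.
Qed.

End Totals.

Theorem theorem5p2 (G : multigraph)
    (rep : {set orientation G} -> orientation G)
    (hrep : forall C, C \in ce_classes G -> rep C \in C) :
  rank_gen_poly G = \sum_(C in ce_classes G) kappa_bar (rep C)
  /\
  negXY (rank_gen_poly G) =
    (-1) ^+ rank [set: edge G] *
    \sum_(C in ce_classes G) (-1) ^+ #|circuit_edges (rep C)| * kappa (rep C).
Proof.
have lifts (p : nat) (ringP : {ffun edge G -> 'I_p.+2} -> bool) intP :
    (forall x, ringP x -> exists2 t, intP t & is_lift x t) ->
    exists l, forall x, ringP x -> intP (l x) /\ is_lift x (l x).
  move=> H; have /choice [l lP] : forall x, exists t, ringP x -> intP t /\ is_lift x t.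
    move=> x; case: (boolP (ringP x)) => [/H [t t1 t2]|_]; first by exists t.
    by exists (fun=> 0).
  by exists l.
split; apply: poly2_eq => p q;
  have [tl tlP] := lifts p _ _ (@tension_lift G p);
  have [gl glP] := lifts q _ _ (@flow_lift G q).
- rewrite rank_gen_polyE !horner_sum.
  under [RHS]eq_bigr => C _ do rewrite kappa_barE.
  have := sum_classes tlP glP (fun=> 1) hrep; rewrite (sum_codes p q (fun=> 1)) => E.
  transitivity (\sum_(C in ce_classes G) \sum_(fg in pairs p q (rep C)) (1 : rat)).
    by rewrite E; apply: eq_bigr => X _; rewrite mul1r.
  by apply: eq_bigr => C _; rewrite sumr_const.
rewrite horner_negXY rank_gen_polyE.
have -> : (-1) ^+ rank [set: edge G] = ((-1) ^+ rank [set: edge G])%:P%:P :> {poly {poly rat}}.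
  by rewrite !rmorphXn !rmorphN1.
rewrite !hornerCM !horner_sum.
have -> : \sum_(C in ce_classes G)
      ((-1) ^+ #|circuit_edges (rep C)| * kappa (rep C)).[p.+2%:R, q.+2%:R] =
    \sum_(r in codes G p q) (if crowded r then (-1) ^+ #|r.2| else 0).
  rewrite -(sum_classes tlP glP _ hrep); apply: eq_bigr => C _; set rho := rep C.
  have -> : (-1) ^+ #|circuit_edges rho| =
      ((-1) ^+ #|circuit_edges rho|)%:P%:P :> {poly {poly rat}}.
    by rewrite !rmorphXn !rmorphN1.
  rewrite !hornerCM kappaE // kappa_countE // mulr_natr -sumr_const.
  rewrite -big_mkcondr; apply: eq_big => [[f g]|fg fgP]; first exact: open_pairs_crowded.
  by rewrite crowded_circuit_edges.
rewrite -sum_codes_sign (sum_codes p q (fun X => (-1) ^+ #|X|)) mulr_sumr.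
apply: eq_bigr => X _; rewrite !mulrA -exprD.
rewrite -[- p.+2%:R]mulN1r -[- q.+2%:R]mulN1r !exprMn mulrACA -exprD -mulrA.
(* The exponents r(E) - r(X) + n(X) and r(E) + |X| differ by 2 r(X); the two rank bounds make the
   truncated subtractions exact. *)
congr (_ * _); rewrite -signr_odd -[RHS]signr_odd; congr (_ ^+ (nat_of_bool _)).
by rewrite /nullity; have := rank_le_card X; have := rank_le X; lia.
Qed.
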